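(* Let $\mathcal S(\mathbb Z_{25})$ denote the set of determinants of $25\times 25$ circulant matrices with integer entries. Then $\mathcal S(\mathbb Z_{25})$ consists exactly of: the integers coprime to $5$; all multiples of $5^4$; and all integers of the form $5^3qm$ where $m$ is an integer with $\gcd(m,5)=1$ and $q$ is a perissad.
   Context: For a prime $p$ and $k\geq1$ let $\omega_k=e^{2\pi i/p^k}$ and for $F\in\mathbb Z[x]$ let $N_k(F)=\prod_{1\leq j\leq p^k,\ p\nmid j}F(\omega_k^j)$ (an integer). Here $p=5$. A prime $q\equiv 1\pmod 5$ is called a perissad (Type 1) if there is $h\in\mathbb Z[x]$ with $5\nmid h(1)$ and $q=N_1(1+(x-1)^3h(x))$. The determinant of the circulant matrix with first row $(a_0,\dots,a_{n-1})$ equals $\prod_{z^n=1}F(z)$ with $F(x)=\sum a_jx^j$. *)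

(* Defs.v *)
From mathcomp Require Import all_boot all_order all_algebra all_field.
Set Implicit Arguments. Unset Strict Implicit. Unset Printing Implicit Defensive.
Import GRing.Theory Num.Theory.
Local Open Scope ring_scope.

(* A fixed primitive (n.-1.+1)-th root of unity in algC; for n >= 1 this is a
   primitive n-th root of unity (playing the role of e^{2 pi i/n}). *)
Definition omega (n : nat) : algC := sval (C_prim_root_exists (ltn0Sn n.-1)).

Definition Nk (p k : nat) (F : {poly int}) : algC :=
  \prod_(1 <= j < (p ^ k).+1 | ~~ (p %| j)%N)
     (map_poly (fun z : int => z%:~R) F).[omega (p ^ k) ^+ j].

Definition perissad (q : nat) : Prop :=
  [/\ prime q, (q %% 5 = 1)%N &
   exists h : {poly int}, ~~ (5 %| h.[1])%Z /\
     (q%:R : algC) = Nk 5 1 (1 + ('X - 1) ^+ 3 * h)].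

Definition circulant (n : nat) (a : nat -> int) : 'M[int]_n :=
  \matrix_(i < n, j < n) a ((j + n - i) %% n)%N.

(* Main.v *)
Require Import Defs.
From mathcomp Require Import all_boot all_order all_algebra all_field cyclic.
From mathcomp Require Import ring zify.
From Stdlib Require Import Classical.
Set Implicit Arguments. Unset Strict Implicit. Unset Printing Implicit Defensive.
Import Order.TTheory GRing.Theory Num.Theory.
Local Open Scope ring_scope.

(* Let [z] be a primitive fifth root of unity, [lam = z - 1] (so [5] is [lam^4] times a
   unit) and [w^5 = z].  The determinant attached to [F] is [F(1) * N(F(z)) * N(R(z))],
   where [R(z)], the relative norm of [F(w)], is given by an integer polynomial [R]
   congruent to [F] modulo [5] with [R(1) = F(1) * N(F(z))].  If [5] divides the product
   it divides every factor.  When the [5]-part is exactly [5^3], write [F(z) = lam g1] and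
   [R(z) = lam g2]; evaluating [R = F + 5 k] at [1] and at [z] shows that [g2 - g1] is
   exactly divisible by [lam^3].

   Call [x] good if its complex conjugate is a power of [z] times [x] modulo [lam^4].
   Conjugation sends [lam^3] to [- lam^3] to leading order, so [g1] and [g2] cannot both be
   good.  Goodness is multiplicative and Z[z] is norm-Euclidean, so a number that is not
   good has a prime factor that is not good; such a prime is not associate to its complex
   conjugate, hence to none of its Galois conjugates, and its norm is a rational prime [q].
   The units [z] and [1 + z] normalize it to [1 + lam^3 h] with [lam] not dividing [h],
   which makes [q] a perissad.

   Conversely [F = X - 1 + Phi_25 * k] leaves [F(w) = w - 1], and since
   [lam^4 = - 5 (z^3 - z^2 + z)] one can choose [k] with [F(z) = lam (1 + lam^3 h(z))].
   Replacing [h] by its conjugates multiplies [h(1)] by powers of [8], which reaches every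
   nonzero class modulo [5] for [F(1) / 5]. *)

(** * Evaluation at a fifth root of unity and the norm *)

Definition ev (x : algC) (f : {poly int}) : algC :=
  (map_poly (fun c : int => c%:~R) f).[x].

Lemma evD x f g : ev x (f + g) = ev x f + ev x g.
Proof. by rewrite /ev rmorphD hornerD. Qed.

Lemma evN x f : ev x (- f) = - ev x f.
Proof. by rewrite /ev rmorphN hornerN. Qed.

Lemma evM x f g : ev x (f * g) = ev x f * ev x g.
Proof. by rewrite /ev rmorphM hornerM. Qed.

Lemma evC x (c : int) : ev x c%:P = c%:~R.
Proof. by rewrite /ev map_polyC hornerC. Qed.

Lemma ev1 x : ev x 1 = 1.
Proof. by rewrite -[1]/(1%:P) evC. Qed.

Lemma evX x : ev x 'X = x.
Proof. by rewrite /ev map_polyX hornerX. Qed.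

Lemma evXn x f n : ev x (f ^+ n) = ev x f ^+ n.
Proof. by rewrite /ev rmorphXn horner_exp. Qed.

Lemma ev_comp x f g : ev x (f \Po g) = ev (ev x g) f.
Proof. by rewrite /ev map_comp_poly horner_comp. Qed.

Lemma ev_at1 f : ev 1 f = (f.[1])%:~R.
Proof. by rewrite /ev -(rmorph1 intr) horner_map. Qed.

Definition evE := (evXn, evD, evN, evM, evX, ev1, evC).

Lemma ev_rmorph (s : {rmorphism algC -> algC}) x f : s (ev x f) = ev (s x) f.
Proof.
rewrite /ev -horner_map -map_poly_comp; congr (_.[_]).
by apply: eq_map_poly => c /=; rewrite rmorph_int.
Qed.

Lemma omega_prim n : (0 < n)%N -> n.-primitive_root (omega n).
Proof. by case: n => // n _; rewrite /omega; case: C_prim_root_exists. Qed.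

Definition z : algC := omega 5.

Lemma z_prim : 5.-primitive_root z. Proof. exact: omega_prim. Qed.

Lemma z_exp5 : z ^+ 5 = 1. Proof. exact: prim_expr_order z_prim. Qed.

Lemma z_neq1 : z - 1 != 0.
Proof. by rewrite subr_eq0 -[z]expr1 -(prim_order_dvd z_prim). Qed.

Lemma z_neq0 : z != 0.
Proof.
apply/eqP => h; have := z_exp5; rewrite h expr0n /=.
by apply/eqP; rewrite eq_sym oner_neq0.
Qed.

Lemma z_sum : 1 + z + z ^+ 2 + z ^+ 3 + z ^+ 4 = 0.
Proof.
apply: (mulfI z_neq1); rewrite mulr0 -[RHS](subrr 1) -[in RHS]z_exp5; move: z_exp5 => h.
have -> : (z - 1) * (1 + z + z ^+ 2 + z ^+ 3 + z ^+ 4) = z ^+ 5 - 1 by ring.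
by rewrite h.
Qed.

Lemma z_exp4 : z ^+ 4 = -1 - z - z ^+ 2 - z ^+ 3.
Proof. by apply/eqP; rewrite -subr_eq0 -[X in _ == X]z_sum; apply/eqP; ring. Qed.

Lemma z_expE n m : (n = m %[mod 5])%N -> z ^+ n = z ^+ m.
Proof. by move=> h; apply/eqP; rewrite (eq_prim_root_expr z_prim); apply/eqP. Qed.

Lemma z_conj : z^* = z ^+ 4.
Proof.
have n1 : `|z| = 1.
  by apply/eqP; rewrite -(pexpr_eq1 (n:=5)) // -normrX z_exp5 normr1.
have h : z * z^* = 1 by rewrite -normCK n1 expr1n.
by apply: (mulfI z_neq0); rewrite h -exprS z_exp5.
Qed.

(** Restricts on Q(z) to a generator of its cyclic Galois group of order 4. Taking it as a morphism
    of the whole of [algC] makes the generic morphism lemmas available. *)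
Definition sg : {rmorphism algC -> algC} := sval (@Qn_aut_exists 2 5 isT).

Lemma sg_z : sg z = z ^+ 2.
Proof. by rewrite /sg; case: Qn_aut_exists => u /= -> //; exact: z_exp5. Qed.

Definition zint (x : algC) := exists f : {poly int}, x = ev z f.

Lemma zintD x y : zint x -> zint y -> zint (x + y).
Proof. by move=> [f ->] [g ->]; exists (f + g); rewrite evE. Qed.
Lemma zintN x : zint x -> zint (- x).
Proof. by move=> [f ->]; exists (- f); rewrite evE. Qed.
Lemma zintB x y : zint x -> zint y -> zint (x - y).
Proof. by move=> hx hy; apply: zintD hx (zintN hy). Qed.
Lemma zintM x y : zint x -> zint y -> zint (x * y).
Proof. by move=> [f ->] [g ->]; exists (f * g); rewrite evE. Qed.
Lemma zintX x n : zint x -> zint (x ^+ n).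
Proof. by move=> [f ->]; exists (f ^+ n); rewrite evE. Qed.
Lemma zint_int (c : int) : zint c%:~R.
Proof. by exists c%:P; rewrite evE. Qed.
Lemma zint_nat n : zint n%:R. Proof. exact: (zint_int n). Qed.
Lemma zint1 : zint 1. Proof. exact: (zint_int 1). Qed.
Lemma zint0 : zint 0. Proof. exact: (zint_int 0). Qed.
Lemma zint_z : zint z.
Proof. by exists 'X; rewrite evE. Qed.
Lemma zint_ev x f : zint x -> zint (ev x f).
Proof. by move=> [g ->]; exists (f \Po g); rewrite ev_comp. Qed.
Lemma zint_sg x : zint x -> zint (sg x).
Proof. by move=> [f ->]; rewrite ev_rmorph sg_z; apply/zint_ev/zintX/zint_z. Qed.
Lemma zint_conj x : zint x -> zint x^*.
Proof. by move=> [f ->]; rewrite ev_rmorph /= z_conj; apply/zint_ev/zintX/zint_z. Qed.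

Ltac zint := repeat first [assumption | apply: zintD | apply: zintM | apply: zintN
  | apply: zintX | exact: zint_z | exact: zint1 | exact: zint_int | exact: zint_nat
  | apply: zint_sg | apply: zint_conj | exact: zint0].

Lemma sg2 x : zint x -> sg (sg x) = x^*.
Proof. by move=> [f ->]; rewrite !ev_rmorph /= z_conj sg_z rmorphXn /= sg_z -exprM. Qed.

Lemma sg_conj x : zint x -> sg x^* = (sg x)^*.
Proof. by move=> hx; rewrite -!sg2 //; zint. Qed.

Lemma sg4 x : zint x -> sg (sg (sg (sg x))) = x.
Proof. by move=> hx; rewrite sg2 ?sg2; try (by zint); exact: conjCK. Qed.

Lemma zint_coords x : zint x -> exists a b c d : int,
  x = a%:~R + b%:~R * z + c%:~R * z ^+ 2 + d%:~R * z ^+ 3.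
Proof.
move=> [f ->]; elim/poly_ind: f => [|f k [a [b [c [d IH]]]]].
  by exists 0, 0, 0, 0; rewrite -[0]/(0%:P) evE; ring.
exists (k - d), (a - d), (b - d), (c - d); rewrite !evE IH !rmorphB /=.
have -> : forall p q r s e : algC, (p + q * z + r * z ^+ 2 + s * z ^+ 3) * z + e =
   e + p * z + q * z ^+ 2 + r * z ^+ 3 + s * z ^+ 4 by move=> *; ring.
rewrite z_exp4; ring.
Qed.

(** The absolute norm of Q(z): [x] and its complex conjugate are one pair of Galois conjugates, and
    [sg] produces the other pair. *)
Definition nm (x : algC) : algC := x * x^* * sg (x * x^*).

(** * The norm as a quartic form in five coefficients *)

Section FiveTerms.
Variable R : comPzRingType.

(** Cyclic autocorrelations at lags 0, 1 and 2; lags 4 and 3 repeat lags 1 and 2. *)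
Definition acor0 (e0 e1 e2 e3 e4 : R) := e0 ^+ 2 + e1 ^+ 2 + e2 ^+ 2 + e3 ^+ 2 + e4 ^+ 2.
Definition acor1 (e0 e1 e2 e3 e4 : R) := e0 * e1 + e1 * e2 + e2 * e3 + e3 * e4 + e4 * e0.
Definition acor2 (e0 e1 e2 e3 e4 : R) := e0 * e2 + e1 * e3 + e2 * e4 + e3 * e0 + e4 * e1.

(** With u = y + y^4 and u' = -1 - u, so that u u' = -1, this is (p + r u + s u')(p + r u' + s u).
    The redundant fifth coefficient leaves the division algorithm more choice of quotients. *)
Definition nmform (e0 e1 e2 e3 e4 : R) :=
  let p := acor0 e0 e1 e2 e3 e4 in let r := acor1 e0 e1 e2 e3 e4 in
  let s := acor2 e0 e1 e2 e3 e4 in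
  p ^+ 2 - p * (r + s) + 3 * r * s - r ^+ 2 - s ^+ 2.

Definition lin5 (y e0 e1 e2 e3 e4 : R) :=
  e0 + e1 * y + e2 * y ^+ 2 + e3 * y ^+ 3 + e4 * y ^+ 4.

Lemma lin5_mul_inv y e0 e1 e2 e3 e4 : y ^+ 5 = 1 ->
  lin5 y e0 e1 e2 e3 e4 * lin5 (y ^+ 4) e0 e1 e2 e3 e4 =
  acor0 e0 e1 e2 e3 e4 + acor1 e0 e1 e2 e3 e4 * (y + y ^+ 4)
  + acor2 e0 e1 e2 e3 e4 * (y ^+ 2 + y ^+ 3).
Proof.
move=> y5.
have y8 : (y ^+ 4) ^+ 2 = y ^+ 3 by rewrite -exprM (exprD y 5 3) y5 mul1r.
have y12 : (y ^+ 4) ^+ 3 = y ^+ 2 by rewrite -exprM (exprD y 10 2) (exprM y 5 2) y5 expr1n mul1r.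
have y16 : (y ^+ 4) ^+ 4 = y by rewrite -exprM (exprD y 15 1) (exprM y 5 3) y5 expr1n mul1r.
rewrite /lin5 y8 y12 y16 -[LHS]addr0.
(* As polynomials in [y] the two sides differ by a multiple of 1 - y^5. Adding that vanishing
   multiple leaves an identity in free variables. *)
have -> : 0 = (1 - y ^+ 5) * (e1 * (e1 + e2 * y + e3 * y ^+ 2 + e4 * y ^+ 3)
   + e2 * (e2 + e3 * y + e4 * y ^+ 2) + e3 * (e3 + e4 * y) + e4 * e4).
  by rewrite y5 subrr mul0r.
rewrite /acor0 /acor1 /acor2; ring.
Qed.

Lemma nmform_prod y e0 e1 e2 e3 e4 : 1 + y + y ^+ 2 + y ^+ 3 + y ^+ 4 = 0 ->
  lin5 y e0 e1 e2 e3 e4 * lin5 (y ^+ 4) e0 e1 e2 e3 e4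
  * (lin5 (y ^+ 2) e0 e1 e2 e3 e4 * lin5 (y ^+ 3) e0 e1 e2 e3 e4) =
  nmform e0 e1 e2 e3 e4.
Proof.
move=> y0.
have y5 : y ^+ 5 = 1.
  by apply/eqP; rewrite -subr_eq0 -[X in _ == X](mulr0 (y - 1)) -y0; apply/eqP; ring.
have y10 : (y ^+ 2) ^+ 5 = 1 by rewrite -exprM (exprM y 5 2) y5 expr1n.
have y8 : (y ^+ 2) ^+ 4 = y ^+ 3 by rewrite -exprM (exprD y 5 3) y5 mul1r.
rewrite -y8 !lin5_mul_inv // y8.
have -> : (y ^+ 2) ^+ 2 = y ^+ 4 by rewrite -exprM.
have -> : (y ^+ 2) ^+ 3 = y by rewrite -exprM (exprD y 5 1) y5 mul1r.
rewrite /nmform; set p := acor0 _ _ _ _ _; set r := acor1 _ _ _ _ _; set s := acor2 _ _ _ _ _.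
set u := y + y ^+ 4; have uE : y ^+ 2 + y ^+ 3 = - 1 - u.
  by apply/eqP; rewrite -subr_eq0 -[X in _ == X]y0 /u; apply/eqP; ring.
have u2 : u ^+ 2 = 1 - u.
  have -> : u ^+ 2 = y ^+ 5 * (y ^+ 3 + 2) + y ^+ 2 by rewrite /u; ring.
  rewrite y5.
  have -> : 1 * (y ^+ 3 + 2) + y ^+ 2 = 2 + (y ^+ 2 + y ^+ 3) by ring.
  by rewrite uE; ring.
rewrite uE [y ^+ 4 + y]addrC -/u.
have -> : (p + r * u + s * (-1 - u)) * (p + r * (-1 - u) + s * u) =
  p ^+ 2 - p * (r + s) + (- (r - s) ^+ 2) * (u ^+ 2 + u) + r * s by ring.
rewrite u2; ring.
Qed.

End FiveTerms.

Lemma nm_sg x : zint x -> nm x = x * x^* * (sg x * (sg x)^* ).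
Proof. by move=> hx; rewrite /nm rmorphM /= sg_conj. Qed.

Lemma nm_ev f : nm (ev z f) = ev z f * ev (z ^+ 2) f * ev (z ^+ 3) f * ev (z ^+ 4) f.
Proof.
rewrite nm_sg; last by exists f.
rewrite !ev_rmorph /= sg_z rmorphXn /= z_conj -exprM (@z_expE (4*2) 3) //; ring.
Qed.

Lemma lin5_rmorph (s : {rmorphism algC -> algC}) y (e0 e1 e2 e3 e4 : int) :
  s (lin5 y e0%:~R e1%:~R e2%:~R e3%:~R e4%:~R) =
  lin5 (s y) e0%:~R e1%:~R e2%:~R e3%:~R e4%:~R.
Proof. by rewrite /lin5 !rmorphD ![s (_%:~R * _)]rmorphM !rmorphXn /= !rmorph_int. Qed.

Lemma nm_lin5 (e0 e1 e2 e3 e4 : int) :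
  nm (lin5 z e0%:~R e1%:~R e2%:~R e3%:~R e4%:~R) = (nmform e0 e1 e2 e3 e4)%:~R.
Proof.
have -> : (nmform e0 e1 e2 e3 e4)%:~R =
   nmform (e0%:~R : algC) e1%:~R e2%:~R e3%:~R e4%:~R.
  by rewrite /nmform /acor0 /acor1 /acor2 !(rmorphD, rmorphB, rmorphM, rmorphXn, rmorphN) /=.
rewrite -(@nmform_prod _ z) ?z_sum //.
rewrite nm_sg; last by rewrite /lin5; zint.
by rewrite !lin5_rmorph /= sg_z rmorphXn /= z_conj -exprM (@z_expE (4 * 2) 3).
Qed.

(** Integrality comes from the integral quartic form, positivity from writing the norm as a product
    of two squared absolute values. *)
Lemma nm_int x : zint x -> nm x \is a Num.nat.
Proof.
move=> hx; rewrite natrEint; apply/andP; split.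
  have [a [b [c [d ->]]]] := zint_coords hx.
  have -> : a%:~R + b%:~R * z + c%:~R * z ^+ 2 + d%:~R * z ^+ 3 =
    lin5 z a%:~R b%:~R c%:~R d%:~R 0%:~R by rewrite /lin5 rmorph0; ring.
  by rewrite nm_lin5; apply: intr_int.
by rewrite nm_sg // -!normCK mulr_ge0 // exprn_ge0.
Qed.

Definition nmn (x : algC) : nat := Num.truncn (nm x).
Arguments nmn x%_R.

(** * Division with remainder in Z[z] *)

Lemma nmnE x : zint x -> nm x = (nmn x)%:R.
Proof. by move=> /nm_int h; rewrite /nmn truncnK. Qed.

Lemma nmM x y : nm (x * y) = nm x * nm y.
Proof. by rewrite /nm !rmorphM /=; ring. Qed.

Lemma nmnM x y : zint x -> zint y -> nmn (x * y) = (nmn x * nmn y)%N.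
Proof.
move=> hx hy; apply/eqP; rewrite -(eqr_nat algC) natrM -!nmnE ?nmM //; zint.
Qed.

Lemma nm_intr (c : int) : nm c%:~R = c%:~R ^+ 4.
Proof. by rewrite /nm !rmorphM /= !rmorph_int; ring. Qed.

Lemma nmn_nat n : nmn n%:R = (n ^ 4)%N.
Proof.
by apply/eqP; rewrite -(eqr_nat algC) -nmnE ?(nm_intr n) ?natrX //; zint.
Qed.

Lemma nmn1 : nmn 1 = 1%N. Proof. exact: (nmn_nat 1). Qed.

Lemma nmn_eq0 x : zint x -> (nmn x == 0)%N = (x == 0).
Proof.
move=> hx; rewrite -(eqr_nat algC) -nmnE // /nm mulf_eq0 fmorph_eq0 orbb mulf_eq0.
by rewrite fmorph_eq0 orbb.
Qed.

Lemma nmn_sg x : zint x -> nmn (sg x) = nmn x.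
Proof.
move=> hx; apply/eqP; rewrite -(eqr_nat algC) -!nmnE //; last by zint.
apply/eqP; rewrite nm_sg; last by zint.
by rewrite nm_sg // (sg2 hx) conjCK; ring.
Qed.

Definition cofac (x : algC) : algC := x^* * (sg x * (sg x)^* ).

Lemma zint_cofac x : zint x -> zint (cofac x).
Proof. by move=> hx; rewrite /cofac; zint. Qed.

Lemma mul_cofac x : zint x -> x * cofac x = (nmn x)%:R.
Proof. by move=> hx; rewrite -nmnE // nm_sg // /cofac; ring. Qed.

Definition dv (x y : algC) := exists2 c, zint c & y = x * c.

Lemma dv_mulr x y c : zint c -> dv x y -> dv x (y * c).
Proof. by move=> hc [d hd ->]; exists (d * c); [zint | rewrite mulrA]. Qed.
Lemma dv_mull x y c : zint c -> dv x y -> dv x (c * y).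
Proof. by rewrite mulrC; apply: dv_mulr. Qed.
Lemma dvD x y y' : dv x y -> dv x y' -> dv x (y + y').
Proof. by move=> [c hc ->] [d hd ->]; exists (c + d); [zint | rewrite mulrDr]. Qed.
Lemma dvN x y : dv x y -> dv x (- y).
Proof. by move=> [c hc ->]; exists (- c); [zint | rewrite mulrN]. Qed.
Lemma dvB x y y' : dv x y -> dv x y' -> dv x (y - y').
Proof. by move=> hy hy'; apply: dvD hy (dvN hy'). Qed.
Lemma dvxx x : dv x x.
Proof. by exists 1; [zint | rewrite mulr1]. Qed.
Lemma dv_mul x c : zint c -> dv x (x * c).
Proof. by move=> hc; exists c. Qed.
Lemma dv_trans y x t : dv x y -> dv y t -> dv x t.
Proof. by move=> hx [c hc ->]; apply: dv_mulr. Qed.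

Lemma dv_nmn x y : zint x -> dv x y -> (nmn x %| nmn y)%N.
Proof. by move=> hx [c hc ->]; rewrite nmnM // dvdn_mulr. Qed.

Lemma zintV x : zint x -> nmn x = 1%N -> zint x^-1.
Proof.
move=> hx h; have := mul_cofac hx; rewrite h => xx.
have x0 : x != 0 by rewrite -nmn_eq0 // h.
suff -> : x^-1 = cofac x by apply: zint_cofac.
by apply: (mulfI x0); rewrite xx divff.
Qed.

(** The left side is the sum of the squared pairwise differences; written in the successive gaps,
    the right side minus the left side has only nonnegative coefficients. *)
Lemma sumsq_sorted (w d1 d2 d3 d4 : int) :
  0 <= d1 -> 0 <= d2 -> 0 <= d3 -> 0 <= d4 ->
  5 * (w ^+ 2 + (w + d1) ^+ 2 + (w + d1 + d2) ^+ 2 + (w + d1 + d2 + d3) ^+ 2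
    + (w + d1 + d2 + d3 + d4) ^+ 2) -
  (w + (w + d1) + (w + d1 + d2) + (w + d1 + d2 + d3) + (w + d1 + d2 + d3 + d4)) ^+ 2
  <= 6 * (d1 + d2 + d3 + d4) ^+ 2.
Proof.
move=> h1 h2 h3 h4.
rewrite -subr_ge0; set t := _ - _.
have -> : t = 2 * (d1 * d1) + 6 * (d1 * d2) + 8 * (d1 * d3) + 10 * (d1 * d4)
   + 4 * (d2 * d3) + 8 * (d2 * d4) + 6 * (d3 * d4) + 2 * (d4 * d4) by rewrite /t; ring.
by rewrite !addr_ge0 // mulr_ge0 // mulr_ge0.
Qed.

(** The spread is at most 4n/5, and 6 (4/5)^2 = 96/25 is below 4. *)
Lemma sumsq_gap (n w v1 v2 v3 v4 : int) : 0 < n ->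
  w <= v1 -> v1 <= v2 -> v2 <= v3 -> v3 <= v4 -> 5 * (v4 - w) <= 4 * n ->
  5 * (w ^+ 2 + v1 ^+ 2 + v2 ^+ 2 + v3 ^+ 2 + v4 ^+ 2)
  - (w + v1 + v2 + v3 + v4) ^+ 2 < 4 * n ^+ 2.
Proof.
move=> n0 h1 h2 h3 h4 h5.
have := @sumsq_sorted w (v1 - w) (v2 - v1) (v3 - v2) (v4 - v3).
rewrite !subr_ge0 => /(_ h1 h2 h3 h4).
have e (a b : int) : a + (b - a) = b by ring.
rewrite !e => /le_lt_trans; apply.
have -> : v1 - w + (v2 - v1) + (v3 - v2) + (v4 - v3) = v4 - w by ring.
by nia.
Qed.

(* Five points on a circle of length [n] leave a gap of length at least [n / 5]; cutting
   the circle there puts them in an interval of length at most [4 n / 5]. *)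
Lemma circle_gap (n : int) (l : seq int) : 0 < n -> size l = 5%N ->
  (forall v, v \in l -> 0 <= v < n) ->
  exists g : int -> int, (forall v, exists q, g v = v - n * q) /\
  5 * (\sum_(v <- l) g v ^+ 2) - (\sum_(v <- l) g v) ^+ 2 < 4 * n ^+ 2.
Proof.
move=> n0 sl hl.
(* Cut at [T]: the residues from [T] on go back by one full turn. *)
pose g T v : int := if T <= v then v - n else v.
have gq T v : exists q, g T v = v - n * q.
  by rewrite /g; case: ifP => _; [exists 1; rewrite mulr1 | exists 0; rewrite mulr0 subr0].
suff [T hT] : exists T, 5 * (\sum_(v <- l) g T v ^+ 2) - (\sum_(v <- l) g T v) ^+ 2
    < 4 * n ^+ 2 by exists (g T).
have pl : perm_eq l (sort <=%R l) by rewrite perm_sym; apply/permPl/perm_sort.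
have sortd := sort_le_sorted l.
have := perm_mem pl; have := perm_size pl; rewrite sl.
case: (sort <=%R l) pl sortd => [//|v0 [//|v1 [//|v2 [//|v3 [//|v4 [|//]]]]]] pl.
move=> /= /and5P[h01 h12 h23 h34 _] _ ml.
have /andP[v00 v0n] : 0 <= v0 < n by apply: hl; rewrite ml !inE eqxx ?orbT.
have /andP[v40 v4n] : 0 <= v4 < n by apply: hl; rewrite ml !inE eqxx ?orbT.
have E T : 5 * (\sum_(v <- l) g T v ^+ 2) - (\sum_(v <- l) g T v) ^+ 2 =
  5 * (g T v0 ^+ 2 + g T v1 ^+ 2 + g T v2 ^+ 2 + g T v3 ^+ 2 + g T v4 ^+ 2) -
  (g T v0 + g T v1 + g T v2 + g T v3 + g T v4) ^+ 2.
  by rewrite !(perm_big _ pl) /= !big_cons !big_nil; ring.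
have gge T v : T <= v -> g T v = v - n by rewrite /g => ->.
have glt T v : v < T -> g T v = v by rewrite /g ltNge => /negbTE ->.
have [h|h1] := leP n (5 * (v1 - v0)).
  exists v1; rewrite E (glt _ v0) ?(gge _ v1) ?(gge _ v2) ?(gge _ v3) ?(gge _ v4); try lia.
  have := @sumsq_gap n (v1 - n) (v2 - n) (v3 - n) (v4 - n) v0 n0.
  by move=> H; apply: le_lt_trans (H _ _ _ _ _); try lia.
have [h|h2] := leP n (5 * (v2 - v1)).
  exists v2; rewrite E (glt _ v0) ?(glt _ v1) ?(gge _ v2) ?(gge _ v3) ?(gge _ v4); try lia.
  have := @sumsq_gap n (v2 - n) (v3 - n) (v4 - n) v0 v1 n0.
  by move=> H; apply: le_lt_trans (H _ _ _ _ _); try lia.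
have [h|h3] := leP n (5 * (v3 - v2)).
  exists v3; rewrite E (glt _ v0) ?(glt _ v1) ?(glt _ v2) ?(gge _ v3) ?(gge _ v4); try lia.
  have := @sumsq_gap n (v3 - n) (v4 - n) v0 v1 v2 n0.
  by move=> H; apply: le_lt_trans (H _ _ _ _ _); try lia.
have [h|h4] := leP n (5 * (v4 - v3)).
  exists v4; rewrite E (glt _ v0) ?(glt _ v1) ?(glt _ v2) ?(glt _ v3) ?(gge _ v4); try lia.
  have := @sumsq_gap n (v4 - n) v0 v1 v2 v3 n0.
  by move=> H; apply: le_lt_trans (H _ _ _ _ _); try lia.
(* All four inner gaps are below n/5, so the points already lie close enough together, and the cut
   at [n] moves none of them. *)
exists n; rewrite E !glt; try lia.
by apply: sumsq_gap; lia.
Qed.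

(** AM-GM for the two squared absolute values A and B whose product is the norm: the squared
    quantity is 2 (A + B), and 4 (A - B)^2 is the remainder 20 (acor1 - acor2)^2, since (u - u')^2 =
    5. *)
Lemma nmform_le (e0 e1 e2 e3 e4 : int) :
  16 * nmform e0 e1 e2 e3 e4 <=
  (5 * (e0 ^+ 2 + e1 ^+ 2 + e2 ^+ 2 + e3 ^+ 2 + e4 ^+ 2)
    - (e0 + e1 + e2 + e3 + e4) ^+ 2) ^+ 2.
Proof.
rewrite -subr_ge0.
have -> : (5 * (e0 ^+ 2 + e1 ^+ 2 + e2 ^+ 2 + e3 ^+ 2 + e4 ^+ 2)
    - (e0 + e1 + e2 + e3 + e4) ^+ 2) ^+ 2 - 16 * nmform e0 e1 e2 e3 e4
  = 20 * (acor1 e0 e1 e2 e3 e4 - acor2 e0 e1 e2 e3 e4) ^+ 2.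
  rewrite /nmform /acor0 /acor1 /acor2; ring.
by rewrite mulr_ge0 // sqr_ge0.
Qed.

Lemma sumsq_shift_ge0 (e0 e1 e2 e3 e4 : int) :
  0 <= 5 * (e0 ^+ 2 + e1 ^+ 2 + e2 ^+ 2 + e3 ^+ 2 + e4 ^+ 2)
    - (e0 + e1 + e2 + e3 + e4) ^+ 2.
Proof.
have -> : 5 * (e0 ^+ 2 + e1 ^+ 2 + e2 ^+ 2 + e3 ^+ 2 + e4 ^+ 2)
    - (e0 + e1 + e2 + e3 + e4) ^+ 2 = (e0 - e1) ^+ 2 + (e0 - e2) ^+ 2 + (e0 - e3) ^+ 2
  + (e0 - e4) ^+ 2 + (e1 - e2) ^+ 2 + (e1 - e3) ^+ 2 + (e1 - e4) ^+ 2
  + (e2 - e3) ^+ 2 + (e2 - e4) ^+ 2 + (e3 - e4) ^+ 2 by ring.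
by rewrite !addr_ge0 // sqr_ge0.
Qed.

(** The coefficients of [x * cofac y], with 0 as the fifth one, are five residues modulo n =
    [nmn y]. Lifting them by [circle_gap] makes the norm of [(x - q * y) * cofac y] smaller than
    n^4. As [cofac y] has norm n^3, the remainder has norm below n. *)
Lemma euclid x y : zint x -> zint y -> y != 0 ->
  exists2 q, zint q & (nmn (x - q * y) < nmn y)%N.
Proof.
move=> hx hy y0; set n := nmn y.
have n0 : (0 < n)%N by rewrite lt0n nmn_eq0.
have hxy : zint (x * cofac y) by have := zint_cofac hy => ?; zint.
have [a [b [c [d hc]]]] := zint_coords hxy.
pose m (e : int) : int := (e %% n%:Z)%Z.
have [||v|g [gq gS]] := @circle_gap n%:Z [:: m a; m b; m c; m d; 0] => //.
  by rewrite /m !inE; lia.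
have key e : exists q : int, g (m e) = e - n%:Z * q.
  have [q ->] := gq (m e); exists (q + (e %/ n%:Z)%Z); rewrite /m {2}(divz_eq e n%:Z); ring.
have key0 : exists q : int, g 0 = - n%:Z * q by have [q ->] := gq 0; exists q; ring.
have [qa Ea] := key a; have [qb Eb] := key b; have [qc Ec] := key c.
have [qd Ed] := key d; have [q0 E0] := key0.
pose q := lin5 z qa%:~R qb%:~R qc%:~R qd%:~R q0%:~R.
have hq : zint q by rewrite /q /lin5; zint.
exists q => //.
pose e := lin5 z (g (m a))%:~R (g (m b))%:~R (g (m c))%:~R (g (m d))%:~R (g 0)%:~R.
have eE : e = (x - q * y) * cofac y.
  rewrite mulrBl -mulrA mul_cofac // hc /e /q /lin5 Ea Eb Ec Ed E0.
  by rewrite !rmorphB !rmorphM !rmorphN /= -[(nmn y)%:R]/((n : int)%:~R); ring.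
have : (nmn e < n ^ 4)%N.
  rewrite -(ltr_nat algC) -nmnE; last by rewrite /e /lin5; zint.
  rewrite nm_lin5 -[(n ^ 4)%:R]/((n ^ 4)%N : int)%:~R ltr_int.
  move: gS; rewrite !big_cons !big_nil !addr0 !addrA.
  have := nmform_le (g (m a)) (g (m b)) (g (m c)) (g (m d)) (g 0).
  have := sumsq_shift_ge0 (g (m a)) (g (m b)) (g (m c)) (g (m d)) (g 0).
  set N := nmform _ _ _ _ _; set S := _ - _ => S0 le lt.
  have : 16 * N < 16 * (n%:Z) ^+ 4.
    apply: le_lt_trans le _; have -> : 16 * n%:Z ^+ 4 = (4 * n%:Z ^+ 2) ^+ 2 by ring.
    by rewrite ltr_pXn2r // nnegrE //; lia.
  by rewrite ltr_pM2l // -rmorphXn.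
rewrite eE nmnM; [|by zint; apply: zintN; zint|exact: zint_cofac].
have -> : nmn (cofac y) = (n ^ 3)%N.
  apply/eqP; rewrite -(eqn_pmul2l n0) -expnS -/(nmn y) -nmnM ?mul_cofac ?nmn_nat //.
  exact: zint_cofac.
by rewrite (expnS n 3) ltn_pmul2r // expn_gt0 n0.
Qed.

Lemma bezout x y : zint x -> zint y ->
  exists u v, [/\ zint u, zint v, dv (u * x + v * y) x & dv (u * x + v * y) y].
Proof.
have [n] := ubnP (nmn x); elim: n x y => // n IH x y hn hx hy.
have [->|x0] := eqVneq x 0.
  exists 0, 1; split; try by zint.
    by exists 0; [zint | rewrite mulr0].
  by rewrite mulr0 add0r mul1r; apply: dvxx.
have [q hq lt] := euclid hy hx x0.
have hr : zint (y - q * x) by apply: zintB; zint.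
have [|u [v [hu hv d1 d2]]] := IH (y - q * x) x _ hr hx; first exact: leq_trans lt hn.
move: d1 d2; have -> : u * (y - q * x) + v * x = (v - u * q) * x + u * y by ring.
move=> d1 d2; exists (v - u * q), u; split => //; first by apply: zintB; zint.
rewrite -[X in dv _ X](subrK (q * x) y).
by apply: dvD => //; apply: dv_mull.
Qed.

Definition irr x := [/\ zint x, x != 0, nmn x <> 1%N &
  forall a b, zint a -> zint b -> x = a * b -> nmn a = 1%N \/ nmn b = 1%N].

Lemma irr_prime x a b : irr x -> zint a -> zint b -> dv x (a * b) -> dv x a \/ dv x b.
Proof.
move=> [hx x0 nu hirr] ha hb hab.
have [u [v [hu hv [c hc d1] d2]]] := bezout hx ha.
set g := u * x + v * a in d1 d2; have hg : zint g by rewrite /g; zint.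
have [g1|c1] := hirr _ _ hg hc d1; last first.
  left; apply: dv_trans d2; have := zintV hc c1 => ?; exists c^-1 => //.
  by rewrite d1 mulfK // -nmn_eq0 // c1.
right; have gi := zintV hg g1.
suff -> : b = g^-1 * (u * b * x + v * (a * b)).
  by apply: dv_mull => //; apply: dvD; apply: dv_mull => //; [zint | exact: dvxx].
have -> : u * b * x + v * (a * b) = g * b by rewrite /g; ring.
by rewrite mulKf // -nmn_eq0 // g1.
Qed.

(** * Congruences modulo powers of z - 1 *)

(** Doubling the form gives the sum of the squares of the four coefficients and of their six
    differences; its value 4 leaves finitely many cases. The list is plus or minus the powers of z,
    with z^4 written as -1 - z - z^2 - z^3. *)
Lemma sumsq_eq2 (a b c d : int) :
  2 * acor0 a b c d 0 - acor1 a b c d 0 - acor2 a b c d 0 = 2 ->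
  (a, b, c, d) \in [:: (1, 0, 0, 0); (0, 1, 0, 0); (0, 0, 1, 0); (0, 0, 0, 1);
    (-1, 0, 0, 0); (0, -1, 0, 0); (0, 0, -1, 0); (0, 0, 0, -1);
    (1, 1, 1, 1); (-1, -1, -1, -1)].
Proof.
set L := [:: _; _; _; _; _; _; _; _; _; _].
pose r : seq int := [:: -2; -1; 0; 1; 2].
have inr (e : int) : e ^+ 2 <= 4 -> e \in r.
  move=> he; have : -2 <= e <= 2 by apply/andP; split; nia.
  by rewrite /r !inE; lia.
move=> h.
have h4 : a ^+ 2 + b ^+ 2 + c ^+ 2 + d ^+ 2 + (a - b) ^+ 2 + (a - c) ^+ 2 + (a - d) ^+ 2
  + (b - c) ^+ 2 + (b - d) ^+ 2 + (c - d) ^+ 2 = 4.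
  transitivity (2 * (2 * acor0 a b c d 0 - acor1 a b c d 0 - acor2 a b c d 0)).
    by rewrite /acor0 /acor1 /acor2; ring.
  by rewrite h.
have [ar br cr dr] : [/\ a \in r, b \in r, c \in r & d \in r].
  move: h4 (sqr_ge0 a) (sqr_ge0 b) (sqr_ge0 c) (sqr_ge0 d) (sqr_ge0 (a - b))
    (sqr_ge0 (a - c)) (sqr_ge0 (a - d)) (sqr_ge0 (b - c)) (sqr_ge0 (b - d)) (sqr_ge0 (c - d)).
  move: ((a - b) ^+ 2) ((a - c) ^+ 2) ((a - d) ^+ 2) ((b - c) ^+ 2) ((b - d) ^+ 2)
    ((c - d) ^+ 2) => *.
  by split; apply: inr; lia.
have : all (fun a => all (fun b => all (fun c => all (fun d =>
  (2 * acor0 a b c d 0 - acor1 a b c d 0 - acor2 a b c d 0 == 2) ==> ((a, b, c, d) \in L))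
  r) r) r) r by vm_compute.
move=> /allP/(_ a ar)/allP/(_ b br)/allP/(_ c cr)/allP/(_ d dr)/implyP; apply.
by apply/eqP.
Qed.

(** A case of Kronecker's theorem: adding the two conditions gives the trace of [v * v^*] from the
    real quadratic subfield, a positive definite form in the coefficients whose vectors of value 2
    are listed in [sumsq_eq2]. *)
Lemma unimodular v : zint v -> v * v^* = 1 -> sg v * (sg v)^* = 1 ->
  exists j, v = z ^+ j \/ v = - z ^+ j.
Proof.
move=> hv; have [a [b [c [d vE]]]] := zint_coords hv.
have vL : v = lin5 z a%:~R b%:~R c%:~R d%:~R 0%:~R.
  by rewrite vE /lin5 rmorph0 mul0r addr0.
have sgz4 : (z ^+ 2) ^+ 4 = (z ^+ 4) ^+ 2 by rewrite -!exprM.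
rewrite vL !lin5_rmorph /= sg_z !rmorphXn /= z_conj -sgz4.
rewrite !lin5_mul_inv ?z_exp5 //; last by rewrite -exprM (@z_expE 10 0).
rewrite sgz4 -!exprM [z ^+ (4 * 2)](@z_expE 8 3) // [z ^+ (2 * 2)](@z_expE 4 4) //.
rewrite [z ^+ (2 * 3)](@z_expE 6 1) // expr1.
set P := acor0 _ _ _ _ _; set R := acor1 _ _ _ _ _; set S := acor2 _ _ _ _ _ => e1 e2.
have hint : 2 * acor0 a b c d 0 - acor1 a b c d 0 - acor2 a b c d 0 = 2.
  apply: (@intr_inj algC).
  have -> : (2 * acor0 a b c d 0 - acor1 a b c d 0 - acor2 a b c d 0)%:~R = 2 * P - R - S :> algC.
    rewrite /P /R /S /acor0 /acor1 /acor2.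
    by rewrite !(rmorphD, rmorphB, rmorphM, rmorphXn, rmorphN) /=.
  have -> : 2 * P - R - S = (P + R * (z + z ^+ 4) + S * (z ^+ 2 + z ^+ 3))
     + (P + R * (z ^+ 2 + z ^+ 3) + S * (z ^+ 4 + z))
     - (R + S) * (1 + z + z ^+ 2 + z ^+ 3 + z ^+ 4) by ring.
  by rewrite e1 e2 z_sum; ring.
have := sumsq_eq2 hint; rewrite -vL vE !inE !xpair_eqE.
have z4 := z_exp4.
do 9!(case/orP; first
  (move=> /andP[/andP[/andP[/eqP-> /eqP->] /eqP->] /eqP->];
   first [exists 0%N; left; ring | exists 1%N; left; ring | exists 2%N; left; ring
     | exists 3%N; left; ring | exists 0%N; right; ring | exists 1%N; right; ring
     | exists 2%N; right; ring | exists 3%N; right; ring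
     | exists 4%N; right; rewrite z4; ring])).
by move=> /andP[/andP[/andP[/eqP-> /eqP->] /eqP->] /eqP->]; exists 4%N; left; rewrite z4; ring.
Qed.

Definition lam : algC := z - 1.

Lemma zint_lam : zint lam.
Proof. by apply: zintB; zint. Qed.

Lemma lam_neq0 : lam != 0. Proof. exact: z_neq1. Qed.

Ltac zlam := repeat first [progress zint | exact: zint_lam | apply: zintB].

Lemma five_lam : 5 = lam ^+ 4 * (z ^+ 2 * (1 + z) ^+ 2).
Proof.
apply/eqP; rewrite -subr_eq0; apply/eqP.
(* The last factor is the quotient in the division of 5 - (X - 1)^4 X^2 (1 + X)^2 by the fifth
   cyclotomic polynomial. *)
have -> : 5 - lam ^+ 4 * (z ^+ 2 * (1 + z) ^+ 2) =
   (1 + z + z ^+ 2 + z ^+ 3 + z ^+ 4) * (5 - 5 * z - z ^+ 2 + 3 * z ^+ 3 - z ^+ 4).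
  by rewrite /lam; ring.
by rewrite z_sum mul0r.
Qed.

Lemma dv_lam5 : dv lam 5.
Proof. by rewrite five_lam exprS -!mulrA; apply: dv_mul; zlam. Qed.

Lemma nmn_lam : nmn lam = 5%N.
Proof.
apply/eqP; rewrite -(eqr_nat algC) -nmnE; last by zlam.
have -> : lam = lin5 z (-1)%:~R 1%:~R 0%:~R 0%:~R 0%:~R.
  by rewrite /lam /lin5 rmorphN rmorph1 rmorph0; ring.
by rewrite nm_lin5.
Qed.

Lemma irr_lam : irr lam.
Proof.
split; [exact: zint_lam | exact: lam_neq0 | by rewrite nmn_lam |].
move=> a b ha hb e; have : (nmn a %| 5)%N by rewrite -nmn_lam e nmnM // dvdn_mulr.
move/primeP: (isT : prime 5) => [_ h] /h /orP[/eqP|/eqP] h5; first by left.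
right; have := nmn_lam; rewrite e nmnM // h5; lia.
Qed.

Lemma dv_lamM a b : zint a -> zint b -> dv lam (a * b) -> dv lam a \/ dv lam b.
Proof. exact: irr_prime irr_lam. Qed.

Lemma nmn_int (c : int) : nmn c%:~R = (`|c| ^ 4)%N.
Proof.
apply/eqP; rewrite -(eqr_nat algC) -nmnE; last by zint.
rewrite nm_intr natrX natr_absz intr_norm (exprM _ 2 2) (exprM _ 2 2) real_normK //.
exact: realz.
Qed.

Lemma dv_lam_int (c : int) : dv lam c%:~R <-> (5 %| c)%Z.
Proof.
split=> [h|/dvdzP[k ->]]; last first.
  by rewrite rmorphM /=; apply: dv_mull; [zint | exact: dv_lam5].
have := dv_nmn zint_lam h; rewrite nmn_lam nmn_int Euclid_dvdX // andbT.
by rewrite dvdzE.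
Qed.

Lemma dv_lam_nat n : dv lam n%:R <-> (5 %| n)%N.
Proof. exact: (dv_lam_int n). Qed.

Lemma poly_red1 (f : {poly int}) : exists g, f = f.[1]%:P + ('X - 1) * g.
Proof.
have /factor_theorem[g hg] : root (f - f.[1]%:P) 1 by rewrite /root hornerD hornerN hornerC subrr.
by exists g; rewrite mulrC -hg; ring.
Qed.

Lemma ev_red f : exists2 y, zint y & ev z f = f.[1]%:~R + lam * y.
Proof.
have [g hg] := poly_red1 f; exists (ev z g); first by exists g.
by rewrite {1}hg !evE.
Qed.

Lemma zint_red x : zint x -> exists n : int, exists2 y, zint y & x = n%:~R + lam * y.
Proof. by move=> [f ->]; exists f.[1]; apply: ev_red. Qed.

Lemma dv_lam_ev f : dv lam (ev z f) <-> (5 %| f.[1])%Z.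
Proof.
have [y hy e] := ev_red f; rewrite e -dv_lam_int; split=> h.
  by rewrite -(addrK (lam * y) _%:~R); apply: dvB h _; apply: dv_mul.
by apply: dvD h _; apply: dv_mul.
Qed.

Lemma conj_lam : lam^* = - z ^+ 4 * lam.
Proof.
rewrite /lam rmorphB rmorph1 /= z_conj.
have -> : - z ^+ 4 * (z - 1) = z ^+ 4 - z ^+ 5 by ring.
by rewrite z_exp5.
Qed.

Lemma conj_cong x : zint x -> dv lam (x^* - x).
Proof.
move=> /zint_red[n [y hy ->]]; rewrite rmorphD rmorphM /= rmorph_int conj_lam.
exists (- z ^+ 4 * y^* - y); [by zlam | ring].
Qed.

Lemma sg_cong x : zint x -> dv lam (sg x - x).
Proof.
move=> /zint_red[n [y hy ->]]; rewrite rmorphD rmorphM /= rmorph_int.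
rewrite /lam rmorphB rmorph1 /= sg_z.
exists ((z + 1) * sg y - y); [by zlam | rewrite /lam; ring].
Qed.

(** The Galois group acts trivially modulo [lam], so all four conjugates are congruent to [n]; and
    [lam] divides an integer only if 5 does. *)
Lemma nmn_cong x (n : int) : zint x -> dv lam (x - n%:~R) -> (5 %| (nmn x)%:Z - n ^+ 4)%Z.
Proof.
move=> hx hn; apply/dv_lam_int; rewrite rmorphB rmorphXn /= -[(nmn x)%:~R]/((nmn x)%:R).
rewrite -nmnE // nm_sg //.
have congM (a b : algC) : zint a -> zint b -> dv lam (a - n%:~R) -> forall k,
   dv lam (b - n%:~R ^+ k) -> dv lam (a * b - n%:~R ^+ k.+1).
  move=> ha hb h k h'.
  have -> : a * b - n%:~R ^+ k.+1 = (a - n%:~R) * b + n%:~R * (b - n%:~R ^+ k).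
    by rewrite exprS; ring.
  by apply: dvD; [apply: dv_mulr | apply: dv_mull => //; zint].
have hc y : zint y -> dv lam (y - n%:~R) -> dv lam (y^* - n%:~R).
  by move=> hy h; rewrite -(subrK y y^* ) -addrA; apply: dvD (conj_cong hy) h.
have hs : dv lam (sg x - n%:~R).
  by rewrite -(subrK x (sg x)) -addrA; apply: dvD (sg_cong hx) hn.
rewrite -mulrA; apply: (congM); [by []|by zint|by []|].
apply: (congM); [by zint|by zint|by apply: hc|].
apply: (congM); [by zint|by zint|by []|].
by rewrite expr1; apply: hc => //; zint.
Qed.

Lemma dv_mul2l x y t : x != 0 -> dv (x * y) (x * t) -> dv y t.
Proof. by move=> x0 [c hc e]; exists c => //; apply: (mulfI x0); rewrite e mulrA. Qed.

(** A first-order expansion, which lets the exponent modulo 5 be read off from a congruence modulo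
    lam^2. *)
Lemma zexp_lin j : exists2 t, zint t & z ^+ j = 1 + lam * (j%:R + lam * t).
Proof.
elim: j => [|j [t ht IH]]; first by exists 0; [zint | rewrite expr0; ring].
exists (t + j%:R + lam * t); first by zlam.
by rewrite exprS IH -{1}(subrK 1 z) -/lam -natr1; ring.
Qed.

(* Up to a root of unity, [x] agrees with its complex conjugate modulo [5]. *)
Definition good (x : algC) := exists j, dv (lam ^+ 4) (x^* - z ^+ j * x).

Lemma goodM x y : zint x -> zint y -> good x -> good y -> good (x * y).
Proof.
move=> hx hy [i hi] [j hj]; exists (i + j)%N; rewrite rmorphM /= exprD.
have -> : x^* * y^* - z ^+ i * z ^+ j * (x * y) =
  (x^* - z ^+ i * x) * y^* + z ^+ i * x * (y^* - z ^+ j * y) by ring.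
by apply: dvD; [apply: dv_mulr | apply: dv_mull] => //; zint.
Qed.

Lemma not_dv_lam2 : ~ dv lam 2.
Proof. by move/(dv_lam_nat 2). Qed.

(* The quotient has absolute value 1 at both complex places, so it is a root of unity up
   to sign, and reduction modulo [lam] excludes the sign. *)
Lemma conj_assoc_good x u : zint x -> ~ dv lam x -> zint u -> x^* = x * u -> good x.
Proof.
move=> hx nx hu e.
have x0 : x != 0 by apply/eqP => x0; apply: nx; rewrite x0; exists 0; [zint | rewrite mulr0].
have uu : u * u^* = 1.
  apply: (mulfI x0); rewrite mulr1 -[RHS]conjCK e rmorphM /= e; ring.
have uu' : sg u * (sg u)^* = 1 by rewrite -sg_conj // -rmorphM uu rmorph1.
have [j [uE|uE]] := unimodular hu uu uu'.
  by exists j; rewrite e uE [x * _]mulrC subrr; exists 0; [zint | rewrite mulr0].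
have [t ht zE] := zexp_lin j.
have := conj_cong hx; rewrite e uE.
have -> : x * - z ^+ j - x = - (2 * x + lam * (x * (j%:R + lam * t))) by rewrite zE; ring.
move=> /dvN; rewrite opprK => h.
have : dv lam (2 * x).
  rewrite -[2 * x](addrK (lam * (x * (j%:R + lam * t)))); apply: dvB h _.
  by apply: dv_mul; zlam.
by case/dv_lamM => //; [zint | move/not_dv_lam2].
Qed.

(** Since [lam^*] is -z^4 lam, conjugating [y - x] changes the sign of its leading term. Goodness
    with equal exponents would preserve that sign, and 2 is prime to [lam]. *)
Lemma not_both_good x y b : zint x -> zint y -> zint b -> y - x = lam ^+ 3 * b ->
  ~ dv lam b -> ~ dv lam x -> good x -> good y -> False.
Proof.
move=> hx hy hb e nb nx [i [c hc ei]] [j [d hd ej]].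
have ec : lam^* ^+ 3 * b^* = (y - x)^* by rewrite e rmorphM rmorphXn.
move/eqP: ei; rewrite subr_eq => /eqP ei; move/eqP: ej; rewrite subr_eq => /eqP ej.
have yE : y = x + lam ^+ 3 * b by rewrite -e; ring.
have eq1 : (z ^+ j - z ^+ i) * x =
   lam ^+ 3 * (- z ^+ 12 * b^* - z ^+ j * b + lam * (c - d)).
  have : lam^* ^+ 3 * b^* =
    z ^+ j * (x + lam ^+ 3 * b) - z ^+ i * x + lam ^+ 4 * (d - c).
    by rewrite ec rmorphB /= ei ej yE; ring.
  rewrite conj_lam => h.
  have -> : (z ^+ j - z ^+ i) * x = (- z ^+ 4 * lam) ^+ 3 * b^*
     - z ^+ j * lam ^+ 3 * b - lam ^+ 4 * (d - c) by rewrite h; ring.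
  ring.
have [t ht zi] := zexp_lin i; have [s hs zj] := zexp_lin j.
(* The right side of [eq1] is divisible by lam^2 and [x] is prime to [lam], so the first-order terms
   force i = j modulo 5. *)
have zij : z ^+ j = z ^+ i.
  have h : dv lam ((j%:R - i%:R + lam * (s - t)) * x).
    apply: (dv_mul2l lam_neq0).
    have -> : lam * ((j%:R - i%:R + lam * (s - t)) * x) = (z ^+ j - z ^+ i) * x.
      by rewrite zi zj; ring.
    have e3 : lam ^+ 3 = lam * lam * lam by ring.
    by rewrite eq1 e3 -[lam * lam * lam * _]mulrA; apply: dv_mul; zlam.
  case: (dv_lamM _ _ h) => // [|h']; first by zlam.
  have : dv lam (j%:Z - i%:Z)%:~R.
    rewrite rmorphB /= -[_%:~R - _]/(j%:R - i%:R).
    rewrite -[X in dv _ X](addrK (lam * (s - t))); apply: dvB h' _.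
    by apply: dv_mul; zlam.
  by move/dv_lam_int => hd'; apply: z_expE; lia.
move: eq1; rewrite zij subrr mul0r => /esym/eqP.
rewrite mulf_eq0 expf_eq0 (negbTE lam_neq0) andbF orFb => /eqP eq0.
have : dv lam (2 * b).
  have -> : 2 * b = lam * (c - d) - z ^+ 12 * (b^* - b) - (z ^+ 12 - 1) * b
      - (z ^+ i - 1) * b.
    rewrite -[LHS]addr0 -eq0; ring.
  apply: dvB; first apply: dvB; first apply: dvB.
  - by apply: dv_mul; zlam.
  - by apply: dv_mull; [zint | apply: conj_cong].
  - apply: dv_mulr => //; have [r hr ->] := zexp_lin 12; rewrite addrC addKr.
    by apply: dv_mul; zlam.
  - by apply: dv_mulr => //; rewrite zi addrC addKr; apply: dv_mul; zlam.
by case/dv_lamM => //; [zint | move/not_dv_lam2].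
Qed.

(** * Prime factors that are not good *)

(** The condition on [u^*] is what transfers goodness between [x] and [u * x]. *)
Definition conj_unit (u : algC) :=
  [/\ zint u, nmn u = 1%N & exists j, u^* = z ^+ j * u].

Lemma conj_unitM u v : conj_unit u -> conj_unit v -> conj_unit (u * v).
Proof.
move=> [hu nu [i ui]] [hv nv [j vj]]; split; first by zint.
  by rewrite nmnM // nu nv.
by exists (i + j)%N; rewrite rmorphM /= ui vj exprD; ring.
Qed.

Lemma conj_unitX u n : conj_unit u -> conj_unit (u ^+ n).
Proof.
move=> hu; elim: n => [|n IH]; last by rewrite exprS; apply: conj_unitM.
by rewrite expr0; split; [exact: zint1 | exact: nmn1 | exists 0%N; rewrite rmorph1 expr0 mulr1].
Qed.

Lemma nmn_z : nmn z = 1%N.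
Proof.
apply/eqP; rewrite -(eqr_nat algC) -nmnE; last by zint.
by rewrite /nm z_conj -exprS z_exp5 rmorph1 mulr1.
Qed.

Lemma conj_unit_z : conj_unit z.
Proof. by split; [zint | exact: nmn_z | exists 3%N; rewrite z_conj -exprSr]. Qed.

Lemma conj_unit_1z : conj_unit (1 + z).
Proof.
split; first by zint.
  apply/eqP; rewrite -(eqr_nat algC) -nmnE; last by zint.
  have -> : 1 + z = lin5 z 1%:~R 1%:~R 0%:~R 0%:~R 0%:~R by rewrite /lin5 rmorph1 rmorph0; ring.
  by rewrite nm_lin5.
by exists 4%N; rewrite rmorphD rmorph1 /= z_conj mulrDr mulr1 -exprSr z_exp5 addrC.
Qed.

Lemma solve_mod5 (s t : int) : ~~ (5 %| t)%Z -> exists m : nat, (5 %| s + m%:Z * t)%Z.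
Proof.
move=> nt; have [st tt] := (divz_eq s 5, divz_eq t 5).
have : (t %% 5)%Z \in [:: 1; 2; 3; 4] by rewrite !inE; lia.
have : (s %% 5)%Z \in [:: 0; 1; 2; 3; 4] by rewrite !inE; lia.
move: st tt {nt}; move: (s %/ 5)%Z (t %/ 5)%Z (s %% 5)%Z (t %% 5)%Z => a b c d -> -> {s t}.
rewrite !inE => /orP[/eqP->|/orP[/eqP->|/orP[/eqP->|/orP[/eqP->|/eqP->]]]];
move=> /orP[/eqP->|/orP[/eqP->|/orP[/eqP->|/eqP->]]];
first [exists 0%N; lia | exists 1%N; lia | exists 2%N; lia | exists 3%N; lia | exists 4%N; lia].
Qed.

(** To leading order, each multiplication by [u] adds [t] to the coefficient of lam^(k+1). A
    suitable power makes this coefficient a multiple of 5, hence of lam^4. *)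
Lemma unit_step k u x y (t : int) : zint y -> u = 1 + lam ^+ k.+1 * (t%:~R + lam * y) ->
  ~~ (5 %| t)%Z -> zint x ->
  exists m, exists2 c, zint c & u ^+ m * (1 + lam ^+ k.+1 * x) = 1 + lam ^+ k.+2 * c.
Proof.
move=> hy uE nt /zint_red[s [x' hx' ->]].
have step m : exists2 c, zint c & u ^+ m * (1 + lam ^+ k.+1 * (s%:~R + lam * x')) =
    1 + lam ^+ k.+1 * ((s + m%:Z * t)%:~R + lam * c).
  elim: m => [|m [c hc IH]]; first by exists x' => //; rewrite expr0 mul1r mul0r addr0.
  exists (y + c + lam ^+ k * (t%:~R + lam * y) * ((s + m%:Z * t)%:~R + lam * c)).
    by zlam.
  have -> : s + m.+1%:Z * t = s + m%:Z * t + t by rewrite intS; ring.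
  by rewrite exprS -mulrA IH uE [(_ + t)%:~R]rmorphD /= !exprS; ring.
have [m /dvdzP[q hq]] := solve_mod5 s nt; exists m; have [c hc ->] := step m.
rewrite hq rmorphM /= -[5%:~R]/(5 : algC) five_lam.
exists (q%:~R * (lam ^+ 3 * (z ^+ 2 * (1 + z) ^+ 2)) + c); first by zlam.
by rewrite !exprS; ring.
Qed.

(** Three successive corrections: a power of 1 + z, which is 2 modulo [lam], makes the constant term
    1; a power of z = 1 + lam removes the first-order term; a power of (1 + z)^4 z^3 removes the
    second-order term. *)
Lemma unit_normalize x : zint x -> ~ dv lam x ->
  exists2 u, conj_unit u & exists2 h, zint h & u * x = 1 + lam ^+ 3 * h.
Proof.
move=> hx nx.
have [u0 hu0 [x1 hx1 e1]] : exists2 u, conj_unit u & exists2 h, zint h & u * x = 1 + lam ^+ 1 * h.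
  have [n [y hy xE]] := zint_red hx.
  have nn : ~~ (5 %| n)%Z.
    apply/negP => /dv_lam_int h; apply: nx; rewrite xE; apply: dvD h _.
    by apply: dv_mul.
  have step m : exists2 c, zint c & (1 + z) ^+ m * x = (2 ^+ m * n)%:~R + lam * c.
    elim: m => [|m [c hc IH]]; first by exists y => //; rewrite expr0 !mul1r.
    exists (2 * c + (2 ^+ m * n)%:~R + lam * c); first by zlam.
    rewrite exprS -mulrA IH exprS -mulrA [(2 * _)%:~R]rmorphM /=.
    have -> : 1 + z = 2 + lam by rewrite /lam; ring.
    ring.
  (* 2 generates the units modulo 5; the exponents are the discrete logarithms of the inverses of 1,
     2, 3 and 4. *)
  have [m hm] : exists m : nat, (5 %| 2 ^+ m * n - 1)%Z.
    have : (n %% 5)%Z \in [:: 1; 2; 3; 4] by rewrite !inE; lia.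
    have := divz_eq n 5; move: (n %/ 5)%Z (n %% 5)%Z => a b nE; rewrite nE !inE.
    move=> /orP[/eqP->|/orP[/eqP->|/orP[/eqP->|/eqP->]]];
    [exists 0%N | exists 3%N | exists 1%N | exists 2%N]; rewrite ?(exprS, expr0); lia.
  have [c hc e] := step m; exists ((1 + z) ^+ m); first exact/conj_unitX/conj_unit_1z.
  have /dvdzP[q hq] := hm; have qE : 2 ^+ m * n = 1 + q * 5 by rewrite -hq; ring.
  exists (q%:~R * (lam ^+ 3 * (z ^+ 2 * (1 + z) ^+ 2)) + c); first by zlam.
  rewrite e qE rmorphD rmorphM rmorph1 /= -[5%:~R]/(5 : algC) five_lam; ring.
have [|//|m1 [x2 hx2 e2]] := @unit_step 0 z x1 0 1 zint0 _ isT.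
  by rewrite /lam; ring.
(* The fourth power makes 1 + z congruent to 1 modulo [lam], and z^3 then cancels the first-order
   term: 2 + 3 = 5. The second-order coefficient is 24 + 6 + 3, that is 3 modulo 5. *)
have [w hw wE] : exists2 w, zint w &
    (1 + z) ^+ 4 * z ^+ 3 = 1 + lam ^+ 2 * (3%:~R + lam * w).
  exists (3 + z - z ^+ 2 - z ^+ 3); first by zlam.
  apply/eqP; rewrite -subr_eq0 -(mul0r (-1 - z + 4 * z ^+ 2 + z ^+ 3)) -z_sum; apply/eqP.
  by rewrite /lam; ring.
have [//|m2 [x3 hx3 e3]] := @unit_step 1 _ x2 w 3 hw wE isT.
exists (((1 + z) ^+ 4 * z ^+ 3) ^+ m2 * (z ^+ m1 * u0)).
  apply: conj_unitM; last by apply: conj_unitM => //; apply/conj_unitX/conj_unit_z.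
  by apply/conj_unitX/conj_unitM; apply/conj_unitX; [exact: conj_unit_1z | exact: conj_unit_z].
by exists x3 => //; rewrite -[LHS]mulrA -[z ^+ m1 * u0 * x]mulrA e1 e2 e3.
Qed.

(** If [lam] divided [h], then [u * x] would be 1 modulo lam^4, hence agree with its conjugate
    there, and removing [u] would make [x] good. *)
Lemma not_good_normalize x : zint x -> ~ dv lam x -> ~ good x ->
  exists2 u, conj_unit u & exists2 h, zint h /\ ~ dv lam h & u * x = 1 + lam ^+ 3 * h.
Proof.
move=> hx nx ng; have [u hu [h hh e]] := unit_normalize hx nx.
exists u => //; exists h => //; split => // -[k hk hE]; apply: ng.
have [zu nu [j uj]] := hu; have u0 : u != 0 by rewrite -nmn_eq0 // nu.
(* 4j is -j modulo 5: this power of z undoes the one produced by conjugating [u]. *)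
exists (4 * j)%N; exists (u^-1 * z ^+ (4 * j) * (z ^+ 16 * k^* - k)).
  by have := zintV zu nu => ?; zlam.
apply: (mulfI u0).
have zj : z ^+ (4 * j) * z ^+ j = 1 by rewrite -exprD (@z_expE _ 0) //; lia.
have e' : z ^+ j * u * x^* = 1 + z ^+ 16 * lam ^+ 4 * k^*.
  rewrite -uj -rmorphM e hE rmorphD rmorph1 !rmorphM /= conj_lam; ring.
have -> : u * (x^* - z ^+ (4 * j) * x) = z ^+ (4 * j) * (z ^+ j * u * x^* - u * x).
  have -> : z ^+ (4 * j) * (z ^+ j * u * x^* - u * x) =
    z ^+ (4 * j) * z ^+ j * u * x^* - z ^+ (4 * j) * u * x by ring.
  by rewrite zj; ring.
have -> : u * (lam ^+ 4 * (u^-1 * z ^+ (4 * j) * (z ^+ 16 * k^* - k))) =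
   (u * u^-1) * lam ^+ 4 * z ^+ (4 * j) * (z ^+ 16 * k^* - k) by ring.
by rewrite divff // e' e hE; ring.
Qed.

Lemma irr_sg x : irr x -> irr (sg x).
Proof.
move=> [hx x0 nx h]; split; [by zint | by rewrite fmorph_eq0 | by rewrite nmn_sg |].
move=> a b ha hb e.
have e' : x = sg (sg (sg a)) * sg (sg (sg b)) by rewrite -!rmorphM /= -e sg4.
have := h _ _ _ _ e'; rewrite !nmn_sg; by [apply; zint | zint].
Qed.

Lemma dv_sg x y : dv x y -> dv (sg x) (sg y).
Proof. by move=> [c hc ->]; exists (sg c); [zint | rewrite rmorphM]. Qed.

Lemma irr_dv_prime x n : irr x -> (0 < n)%N -> dv x n%:R ->
  exists q, prime q /\ dv x q%:R.
Proof.
move=> hx; have [zx x0 nx _] := hx.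
have [k] := ubnP n; elim: k n => // k IH n hn n0 h.
have [n1|n1] := leqP n 1.
  have nE : n = 1%N by lia.
  by case: nx; have := dv_nmn zx h; rewrite nE nmn1 dvdn1 => /eqP.
have pn := pdiv_prime n1; have /dvdnP[m nE] := pdiv_dvd n.
move: h; rewrite {1}nE natrM => /(irr_prime hx (zint_nat _) (zint_nat _)) [h|h]; last first.
  by exists (pdiv n).
have p2 := prime_gt1 pn.
by apply: IH h; [nia | lia].
Qed.

(* Two conjugates of [x] are never associate: an associate pair at an odd Galois distance
   would, applied twice, make [x] associate to its complex conjugate.  So the four
   conjugates all divide the rational prime below [x], and with them the norm does. *)
Lemma irr_not_good_nmn x : irr x -> ~ dv lam x -> ~ good x -> prime (nmn x).
Proof.
move=> hx nx ng; have [zx x0 nx1 _] := hx.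
have [q [pq [c hc qE]]] : exists q, prime q /\ dv x q%:R.
  apply: (@irr_dv_prime x (nmn x)) => //; first by rewrite lt0n nmn_eq0.
  by rewrite -mul_cofac //; apply/dv_mul/zint_cofac.
have y2 : sg (sg x) = x^* by rewrite sg2.
have y4 : sg (sg (sg (sg x))) = x by rewrite sg4.
have n01 : ~ dv x (sg x).
  move=> [v hv e]; apply: ng; apply: (@conj_assoc_good x (v * sg v)) => //; first by zint.
  by rewrite -y2 e rmorphM /= e; ring.
have n10 : ~ dv (sg x) x.
  move=> [v hv e]; apply: ng; apply: (@conj_assoc_good x (sg v * v)^* ) => //; first by zint.
  have xE : x = x^* * (sg v * v) by rewrite {1}e -y2 {1}e rmorphM /=; ring.
  by rewrite {1}xE rmorphM /= conjCK.
have n20 : ~ dv (sg (sg x)) x.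
  rewrite y2 => -[v hv e]; apply: ng; apply: (@conj_assoc_good x v^* ) => //; first by zint.
  by rewrite {1}e rmorphM /= conjCK.
have h1 := irr_sg hx; have h2 := irr_sg h1; have h3 := irr_sg h2.
(* [q] is fixed by [sg], so each conjugate of [x] divides it. Since none divides an earlier one,
   each passes to the cofactor left by its predecessors. *)
have [c1 hc1 cE] : dv (sg x) c.
  have : dv (sg x) (x * c) by rewrite -qE -(rmorph_nat sg) qE rmorphM; apply: dv_mul; zint.
  by case/(irr_prime h1 zx hc).
have qE1 : q%:R = x * (sg x * c1) by rewrite qE cE.
have [c2 hc2 c1E] : dv (sg (sg x)) c1.
  have : dv (sg (sg x)) (x * (sg x * c1)).
    by rewrite -qE1 -(rmorph_nat sg) -(rmorph_nat sg) qE !rmorphM /=; apply: dv_mul; zint.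
  case/(irr_prime h2 zx); [by zint | by [] |].
  case/(irr_prime h2); [by zint | by [] | | by []].
  by move/dv_sg/dv_sg/dv_sg; rewrite !y4.
have qE2 : q%:R = x * (sg x * (sg (sg x) * c2)) by rewrite qE1 c1E.
have [c3 hc3 c2E] : dv (sg (sg (sg x))) c2.
  have : dv (sg (sg (sg x))) (x * (sg x * (sg (sg x) * c2))).
    rewrite -qE2 -(rmorph_nat sg) -(rmorph_nat sg) -(rmorph_nat sg) qE !rmorphM /=.
    by apply: dv_mul; zint.
  case/(irr_prime h3 zx); [by zint | |].
    by move/dv_sg; rewrite y4.
  case/(irr_prime h3); [by zint | by zint | |].
    by move/dv_sg/dv_sg/dv_sg; rewrite !y4.
  case/(irr_prime h3); [by zint | by [] | | by []].
  by move/dv_sg/dv_sg; rewrite !y4.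
have : dv (nmn x)%:R q%:R.
  exists c3 => //; rewrite qE2 c2E -nmnE // nm_sg // -sg_conj // -y2.
  ring.
(* Taking norms of these two integers compares their fourth powers, which descends to the integers
   themselves. *)
move/(dv_nmn (zint_nat _)); rewrite !nmn_nat dvdn_pexp2r //.
by move=> h; case/primeP: (pq) => _ /(_ _ h)/orP[/eqP|/eqP->].
Qed.

Lemma prod_coprime5 (g : nat -> algC) :
  \prod_(1 <= j < 6 | ~~ (5 %| j)%N) g j = g 1%N * g 2%N * g 3%N * g 4%N.
Proof. by rewrite big_mkcond unlock /= !mulr1 !mulrA. Qed.

Lemma Nk_nm f : Nk 5 1 f = nm (ev z f).
Proof. by rewrite nm_ev -[in ev z f](expr1 z) -(prod_coprime5 (fun j => ev (z ^+ j) f)). Qed.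

(** Induction on the norm. By [goodM] a proper factorization has a factor that is not good; at an
    irreducible element the norm is prime and the normalized form supplies the perissad witness. *)
Lemma perissad_dvd x : zint x -> ~ dv lam x -> ~ good x ->
  exists2 q, perissad q & (q %| nmn x)%N.
Proof.
have [k] := ubnP (nmn x); elim: k x => // k IH x hk hx nx ng.
have x0 : x != 0 by apply/eqP => x0; apply: nx; rewrite x0; exists 0; [zint | rewrite mulr0].
have nx1 : nmn x <> 1%N.
  move=> n1; apply: ng; have := zintV hx n1 => ?.
  by apply: (@conj_assoc_good x (x^-1 * x^* )) => //; [zint | rewrite mulVKf].
have [hirr|nirr] := classic (irr x).
  have pq := irr_not_good_nmn hirr nx ng; exists (nmn x) => //.
  have [u [zu nu _] [h [[f hf] nh] e]] := not_good_normalize hx nx ng.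
  have zux : zint (u * x) by zint.
  have nE : nmn x = nmn (u * x) by rewrite nmnM // nu mul1n.
  split=> //; last first.
    exists f; split; first by apply/negP => /dv_lam_ev; rewrite -hf.
    by rewrite Nk_nm nE -nmnE // e !evE /= -hf.
  have : (5 %| (nmn x)%:Z - 1 ^+ 4)%Z.
    rewrite nE; apply: nmn_cong => //; rewrite e addrC addKr exprS -mulrA.
    by apply: dv_mul; rewrite hf; zlam; exists f.
  by rewrite expr1n; lia.
have [a [b [ha hb xE [na nb]]]] : exists a b, [/\ zint a, zint b, x = a * b
    & nmn a <> 1%N /\ nmn b <> 1%N].
  apply: NNPP => hN; apply: nirr; split => // a b ha hb xE.
  apply: NNPP => hN'; apply: hN; exists a, b; split => //.
  by split=> h; apply: hN'; [left | right].
have na0 : (nmn a != 0)%N by rewrite nmn_eq0 //; apply: contraNneq x0 => a0; rewrite xE a0 mul0r.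
have nb0 : (nmn b != 0)%N by rewrite nmn_eq0 //; apply: contraNneq x0 => b0; rewrite xE b0 mulr0.
have nE : nmn x = (nmn a * nmn b)%N by rewrite xE nmnM.
have la : ~ dv lam a by move=> h; apply: nx; rewrite xE; apply: dv_mulr.
have lb : ~ dv lam b by move=> h; apply: nx; rewrite xE; apply: dv_mull.
have [ga|nga] := classic (good a).
  have ngb : ~ good b by move=> gb; apply: ng; rewrite xE; apply: goodM.
  have [|q hq qb] := IH b _ hb lb ngb; first by nia.
  by exists q => //; rewrite nE dvdn_mull.
have [|q hq qa] := IH a _ ha la nga; first by nia.
by exists q => //; rewrite nE dvdn_mulr.
Qed.

(** * Circulants and the relative norm *)

(** Built from [z] so that w^5 is [z] itself. *)
Definition w : algC := 5.-root z.

Lemma w_exp5 : w ^+ 5 = z. Proof. by rewrite /w rootCK. Qed.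

Lemma w_exp k : w ^+ (5 * k) = z ^+ k. Proof. by rewrite exprM w_exp5. Qed.

Lemma w_exp25 : w ^+ 25 = 1. Proof. by rewrite (w_exp 5) z_exp5. Qed.

Lemma w_prim : 25.-primitive_root w.
Proof.
have [m pm m25] := prim_order_exists (isT : (0 < 25)%N) w_exp25.
have : m \in divisors 25 by rewrite -dvdn_divisors.
rewrite (_ : divisors 25 = [:: 1; 5; 25]%N) // !inE.
case/orP=> [/eqP mE|/orP[/eqP mE|/eqP <-//]]; have := z_neq1.
  by rewrite -w_exp5 (_ : w = 1) ?expr1n ?subrr ?eqxx // -[w]expr1 -mE (prim_expr_order pm).
by rewrite -w_exp5 -mE (prim_expr_order pm) subrr eqxx.
Qed.

Lemma ev_poly n (a : nat -> int) (y : algC) :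
  ev y (\poly_(i < n) a i) = \sum_(i < n) (a i)%:~R * y ^+ i.
Proof.
rewrite /ev poly_def rmorph_sum horner_sum; apply: eq_bigr => i _ /=.
by rewrite map_polyZ hornerZ map_polyXn hornerXn.
Qed.

(** The Vandermonde matrix on the 25th roots of unity diagonalizes every circulant; it is invertible
    because its nodes are distinct. *)
Lemma det_circulant (a : nat -> int) :
  (\det (circulant 25 a))%:~R = \prod_(k < 25) ev (w ^+ k) (\poly_(i < 25) a i).
Proof.
pose C := map_mx (intr : int -> algC) (circulant 25 a).
pose v : 'rV[algC]_25 := \row_k w ^+ k.
pose V := Vandermonde 25 v.
pose d : 'rV[algC]_25 := \row_k ev (w ^+ k) (\poly_(i < 25) a i).
have CV : C *m V = V *m diag_mx d.
  apply/matrixP => i k; rewrite mul_mx_diag !mxE.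
  set y := w ^+ k; have y25 : y ^+ 25 = 1 by rewrite /y exprAC w_exp25 expr1n.
  rewrite ev_poly mulr_sumr (reindex_inj (addIr i)) /=; apply: eq_bigr => m _.
  rewrite !mxE -/y expr_mod // exprD.
  have -> : (((m + i) %% 25 + 25 - i) %% 25 = m)%N.
    by have := ltn_ord m; have := ltn_ord i; lia.
  ring.
have dV : \det V != 0.
  rewrite det_Vandermonde; apply/prodf_neq0 => i _; apply/prodf_neq0 => j ij.
  rewrite !mxE subr_eq0 (eq_prim_root_expr w_prim) !modn_small //.
  by rewrite eq_sym neq_ltn ij.
have : \det C * \det V = \det V * \prod_k d 0 k by rewrite -det_diag -!det_mulmx CV.
rewrite mulrC => /(mulfI dV); rewrite /C det_map_mx => ->.
by apply: eq_bigr => k _; rewrite mxE.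
Qed.

Lemma circulant_of_poly (f : {poly int}) : exists a : nat -> int,
  (\det (circulant 25 a))%:~R = \prod_(k < 25) ev (w ^+ k) f.
Proof.
have mon : ('X^25 - 1 : {poly int}) \is monic by rewrite monicXnsubC.
pose r := Pdiv.Ring.rmodp f ('X^25 - 1).
exists (fun i => r`_i); rewrite det_circulant; apply: eq_bigr => k _.
have sr : (size r <= 25)%N.
  by rewrite -ltnS -(size_XnsubC (1 : int) (isT : (0 < 25)%N)) Pdiv.Ring.ltn_rmodp monic_neq0.
have -> : \poly_(i < 25) r`_i = r.
  by apply/polyP => i; rewrite coef_poly; case: ltnP => // h; rewrite nth_default // (leq_trans sr).
rewrite [in RHS](Pdiv.RingMonic.rdivp_eq mon f) -/r !evE.
by rewrite exprAC w_exp25 expr1n subrr mulr0 add0r.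
Qed.

Lemma ev_nat x n : ev x n%:R = n%:R.
Proof. by rewrite -(rmorph_nat (@polyC int)) evC rmorph_nat. Qed.

Lemma fermat5 (c : int) : exists m : int, c ^+ 5 = c + 5 * m.
Proof.
have hr : exists s : int, (c %% 5)%Z ^+ 5 = (c %% 5)%Z + 5 * s.
  have : (c %% 5)%Z \in [:: 0; 1; 2; 3; 4] by rewrite !inE; lia.
  rewrite !inE => /orP[/eqP->|/orP[/eqP->|/orP[/eqP->|/orP[/eqP->|/eqP->]]]];
  [by exists 0 | by exists 0 | by exists 6 | by exists 48 | by exists 204].
have [s hs] := hr; rewrite (divz_eq c 5).
move: (c %/ 5)%Z (c %% 5)%Z hs => q r hs {hr}.
exists (625 * q ^+ 5 + 625 * r * q ^+ 4 + 250 * r ^+ 2 * q ^+ 3 + 50 * r ^+ 3 * q ^+ 2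
  + 5 * r ^+ 4 * q - q + s).
transitivity (5 * (625 * q ^+ 5 + 625 * r * q ^+ 4 + 250 * r ^+ 2 * q ^+ 3
  + 50 * r ^+ 3 * q ^+ 2 + 5 * r ^+ 4 * q) + r ^+ 5); first by ring.
by rewrite hs; ring.
Qed.

Lemma frobenius5 (f : {poly int}) : exists k, f ^+ 5 = (f \Po 'X^5) + 5 * k.
Proof.
elim/poly_ind: f => [|f c [k IH]].
  by exists 0; rewrite comp_poly0 expr0n mulr0 addr0.
have [m hm] := fermat5 c.
have cE : c%:P ^+ 5 = c%:P + 5 * m%:P :> {poly int}.
  by rewrite -rmorphXn /= hm rmorphD rmorphM rmorph_nat.
(* The mixed terms of the binomial expansion, with coefficients 5, 10, 10, 5 divided by 5. *)
pose g := (f * 'X) ^+ 4 * c%:P + 2 * (f * 'X) ^+ 3 * c%:P ^+ 2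
  + 2 * (f * 'X) ^+ 2 * c%:P ^+ 3 + (f * 'X) * c%:P ^+ 4.
exists (k * 'X^5 + m%:P + g); rewrite comp_polyD comp_polyM comp_polyX comp_polyC.
transitivity (f ^+ 5 * 'X^5 + c%:P ^+ 5 + 5 * g); first by rewrite /g; ring.
by rewrite IH cE; ring.
Qed.

Lemma poly_split5 (f : {poly int}) : exists f0 f1 f2 f3 f4 : {poly int},
  f = (f0 \Po 'X^5) + (f1 \Po 'X^5) * 'X + (f2 \Po 'X^5) * 'X^2 + (f3 \Po 'X^5) * 'X^3
    + (f4 \Po 'X^5) * 'X^4.
Proof.
elim/poly_ind: f => [|f c [f0 [f1 [f2 [f3 [f4 IH]]]]]].
  by exists 0, 0, 0, 0, 0; rewrite comp_poly0; ring.
exists (f4 * 'X + c%:P), f0, f1, f2, f3.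
by rewrite IH comp_polyD comp_polyM comp_polyX comp_polyC; ring.
Qed.

(* The quotient by [5] of [det - (b0^5 + .. + b4^5)] for the 5x5 circulant on
   [b_r = f_r t^r], written in [y = t^5]. *)
Definition circ5_quot (R : comPzRingType) (y f0 f1 f2 f3 f4 : R) : R :=
    - f0 ^+ 3 * f1 * f4 * y - f0 ^+ 3 * f2 * f3 * y + f0 ^+ 2 * f1 ^+ 2 * f3 * y + f0 ^+ 2
  * f1 * f2 ^+ 2 * y + f0 ^+ 2 * f2 * f4 ^+ 2 * y ^+ 2 + f0 ^+ 2 * f3 ^+ 2 * f4 * y ^+ 2 -
  f0 * f1 ^+ 3 * f2 * y + f0 * f1 ^+ 2 * f4 ^+ 2 * y ^+ 2 - f0 * f1 * f2 * f3 * f4 * y ^+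
  2 - f0 * f1 * f3 ^+ 3 * y ^+ 2 - f0 * f2 ^+ 3 * f4 * y ^+ 2 + f0 * f2 ^+ 2 * f3 ^+ 2 * y
  ^+ 2 - f0 * f3 * f4 ^+ 3 * y ^+ 3 - f1 ^+ 3 * f3 * f4 * y ^+ 2 + f1 ^+ 2 * f2 ^+ 2 * f4
  * y ^+ 2 + f1 ^+ 2 * f2 * f3 ^+ 2 * y ^+ 2 - f1 * f2 ^+ 3 * f3 * y ^+ 2 - f1 * f2 * f4
  ^+ 3 * y ^+ 3 + f1 * f3 ^+ 2 * f4 ^+ 2 * y ^+ 3 + f2 ^+ 2 * f3 * f4 ^+ 2 * y ^+ 3 - f2 *
  f3 ^+ 3 * f4 * y ^+ 3.

Lemma circ5E (R : comPzRingType) (t f0 f1 f2 f3 f4 : R) :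
  let b1 := f1 * t in let b2 := f2 * t ^+ 2 in let b3 := f3 * t ^+ 3 in
  let b4 := f4 * t ^+ 4 in
  (f0 + b1 + b2 + b3 + b4) * nmform f0 b1 b2 b3 b4 =
  f0 ^+ 5 + f1 ^+ 5 * t ^+ 5 + f2 ^+ 5 * (t ^+ 5) ^+ 2 + f3 ^+ 5 * (t ^+ 5) ^+ 3
  + f4 ^+ 5 * (t ^+ 5) ^+ 4 + 5 * circ5_quot (t ^+ 5) f0 f1 f2 f3 f4.
Proof. by rewrite /nmform /acor0 /acor1 /acor2 /circ5_quot; ring. Qed.

Lemma lin5_prod_all y (b0 b1 b2 b3 b4 : algC) : 1 + y + y ^+ 2 + y ^+ 3 + y ^+ 4 = 0 ->
  (b0 + b1 + b2 + b3 + b4) * nmform b0 b1 b2 b3 b4 =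
  lin5 1 b0 b1 b2 b3 b4 * lin5 y b0 b1 b2 b3 b4 * lin5 (y ^+ 2) b0 b1 b2 b3 b4
  * lin5 (y ^+ 3) b0 b1 b2 b3 b4 * lin5 (y ^+ 4) b0 b1 b2 b3 b4.
Proof.
move=> hy; rewrite -(nmform_prod _ _ _ _ _ hy).
have -> : lin5 1 b0 b1 b2 b3 b4 = b0 + b1 + b2 + b3 + b4.
  by rewrite /lin5 !expr1n !mulr1.
ring.
Qed.

(* The relative norm of [f(w)] from Q(w) to Q(w^5) is the value at [w^5] of a polynomial
   congruent to [f] modulo [5]. *)
Lemma relative_norm (f : {poly int}) : exists k : {poly int}, forall t : algC,
  ev t f * ev (t * z) f * ev (t * z ^+ 2) f * ev (t * z ^+ 3) f * ev (t * z ^+ 4) f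
  = ev (t ^+ 5) (f + 5 * k).
Proof.
have [f0 [f1 [f2 [f3 [f4 fE]]]]] := poly_split5 f.
have [k0 e0] := frobenius5 f0; have [k1 e1] := frobenius5 f1.
have [k2 e2] := frobenius5 f2; have [k3 e3] := frobenius5 f3.
have [k4 e4] := frobenius5 f4.
exists (k0 + k1 * 'X + k2 * 'X^2 + k3 * 'X^3 + k4 * 'X^4 + circ5_quot 'X f0 f1 f2 f3 f4) => t.
set y := t ^+ 5.
have -> : f + 5 * (k0 + k1 * 'X + k2 * 'X^2 + k3 * 'X^3 + k4 * 'X^4
    + circ5_quot 'X f0 f1 f2 f3 f4) =
  f0 ^+ 5 + f1 ^+ 5 * 'X + f2 ^+ 5 * 'X^2 + f3 ^+ 5 * 'X^3 + f4 ^+ 5 * 'X^4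
    + 5 * circ5_quot 'X f0 f1 f2 f3 f4.
  by rewrite e0 e1 e2 e3 e4 {1}fE; ring.
have -> : ev y (f0 ^+ 5 + f1 ^+ 5 * 'X + f2 ^+ 5 * 'X^2 + f3 ^+ 5 * 'X^3 + f4 ^+ 5 * 'X^4
    + 5 * circ5_quot 'X f0 f1 f2 f3 f4) =
  ev y f0 ^+ 5 + ev y f1 ^+ 5 * y + ev y f2 ^+ 5 * y ^+ 2 + ev y f3 ^+ 5 * y ^+ 3
  + ev y f4 ^+ 5 * y ^+ 4 + 5 * circ5_quot y (ev y f0) (ev y f1) (ev y f2) (ev y f3) (ev y f4).
  have cE : ev y (circ5_quot 'X f0 f1 f2 f3 f4) =
    circ5_quot y (ev y f0) (ev y f1) (ev y f2) (ev y f3) (ev y f4).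
    by rewrite /circ5_quot !(evD, evN, evM, evXn, evX).
  by rewrite !(cE, evE, ev_nat).
rewrite -circ5E (lin5_prod_all _ _ _ _ _ z_sum).
have fz i : ev (t * z ^+ i) f = lin5 (z ^+ i) (ev y f0) (ev y f1 * t)
     (ev y f2 * t ^+ 2) (ev y f3 * t ^+ 3) (ev y f4 * t ^+ 4).
  rewrite [in LHS]fE !evD !evM !ev_comp !evE /lin5.
  have -> : (t * z ^+ i) ^+ 5 = y by rewrite exprMn exprAC z_exp5 expr1n mulr1.
  ring.
have := (fz 0%N, fz 1%N); rewrite expr0 mulr1 expr1 => -[-> ->].
by rewrite !fz.
Qed.

Lemma prod24 (g : nat -> algC) : \prod_(k < 24) g k.+1 =
  (g 5%N * g 10%N * g 15%N * g 20%N) *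
  ((g 1%N * g 6%N * g 11%N * g 16%N * g 21%N) * (g 2%N * g 7%N * g 12%N * g 17%N * g 22%N) *
   (g 3%N * g 8%N * g 13%N * g 18%N * g 23%N) * (g 4%N * g 9%N * g 14%N * g 19%N * g 24%N)).
Proof. by rewrite -(big_mkord xpredT (fun k => g k.+1)) unlock /=; ring. Qed.

Lemma prod_w (f : {poly int}) :
  \prod_(j < 25) ev (w ^+ j) f = ev 1 f * \prod_(j < 24) ev (w ^+ j.+1) f.
Proof. by rewrite big_ord_recl expr0. Qed.

(** Exponents divisible by 5 give the norm of f(z). The others, grouped by residue i modulo 5, are
    relative norms at t = w^i, that is, the conjugates of R(z) for R = f + 5 k. The second equation
    is the relative norm at t = 1. *)
Lemma norm_factor (f : {poly int}) : exists k : {poly int},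
  \prod_(j < 24) ev (w ^+ j.+1) f = nm (ev z f) * nm (ev z (f + 5 * k)) /\
  ev 1 f * nm (ev z f) = ev 1 (f + 5 * k).
Proof.
have [k hk] := relative_norm f; exists k.
have e1 : ev 1 f * nm (ev z f) = ev 1 (f + 5 * k).
  by rewrite -{2}(expr1n _ 5) -hk nm_ev !mul1r !mulrA.
split=> //; rewrite (prod24 (fun j => ev (w ^+ j) f)) nm_ev.
rewrite (w_exp 1) (w_exp 2) (w_exp 3) (w_exp 4) expr1; congr (_ * _).
have step i : ev (z ^+ i) (f + 5 * k) = ev (w ^+ i) f * ev (w ^+ (i + 5)) f *
  ev (w ^+ (i + 10)) f * ev (w ^+ (i + 15)) f * ev (w ^+ (i + 20)) f.
  rewrite -w_exp mulnC exprM -hk !exprD.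
  by rewrite w_exp5 (w_exp 2) (w_exp 3) (w_exp 4).
by rewrite nm_ev -[in ev z _](expr1 z) !step.
Qed.

(** * Necessity: the power of 5 in a determinant *)

Lemma coprimez5 (m : int) : coprimez m 5 = ~~ (5 %| m)%Z.
Proof.
by rewrite coprimezE coprime_sym prime_coprime // dvdzE.
Qed.

Lemma dvd5M (a b : int) : (5 %| a * b)%Z = (5 %| a)%Z || (5 %| b)%Z.
Proof. by rewrite !dvdzE abszM Euclid_dvdM. Qed.

Lemma dvd5X (a : int) n : (5 %| a ^+ n)%Z -> (5 %| a)%Z.
Proof. by elim: n => [|n IH] //; rewrite exprS dvd5M => /orP[|/IH]. Qed.

Lemma group_det_cases (f : {poly int}) (d : int) :
  d%:~R = \prod_(j < 25) ev (w ^+ j) f ->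
  [\/ coprimez d 5, (5 ^+ 4 %| d)%Z
    | exists (q : nat) (m : int), perissad q /\ coprimez m 5 /\ d = 5 ^+ 3 * q%:Z * m].
Proof.
move=> dE; have [k [pE e1]] := norm_factor f.
set R := f + 5 * k in pE e1; set m := f.[1].
have zf : zint (ev z f) by exists f.
have zR : zint (ev z R) by exists R.
set n1 := nmn (ev z f); set n2 := nmn (ev z R).
have dE' : d = m * n1%:Z * n2%:Z.
  by apply: (@intr_inj algC); rewrite dE prod_w pE ev_at1 !nmnE // !rmorphM /= mulrA.
have R1 : R.[1] = m * n1%:Z.
  by apply: (@intr_inj algC); rewrite -ev_at1 -e1 ev_at1 nmnE // rmorphM.
have R1' : R.[1] = m + 5 * k.[1].
  by apply: (@intr_inj algC); rewrite -ev_at1 /R evD evM ev_nat !ev_at1 rmorphD rmorphM.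
have cg g : (5 %| (nmn (ev z g))%:Z - g.[1] ^+ 4)%Z.
  apply: nmn_cong; first by exists g.
  by have [y hy ->] := ev_red g; rewrite addrC addKr; apply: dv_mul.
have cg1 := cg f; have cg2 := cg R; rewrite -/n1 -/m in cg1; rewrite -/n2 in cg2.
have [nd|] := boolP (coprimez d 5); first by constructor 1.
rewrite coprimez5 negbK => d5.
(* [n1] is m^4 and [n2] is R(1)^4 modulo 5, while R(1) = m n1; so a factor 5 anywhere already occurs
   in [m]. *)
have m5 : (5 %| m)%Z.
  have imp : (5 %| n1%:Z)%Z -> (5 %| m)%Z.
    by move=> h; apply: (@dvd5X _ 4); move: h cg1; move: (m ^+ 4) => ?; lia.
  move: d5; rewrite dE' !dvd5M => /orP[/orP[//|/imp//]|h].
  have : (5 %| R.[1])%Z by apply: (@dvd5X _ 4); move: h cg2; move: (R.[1] ^+ 4) => ?; lia.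
  by rewrite R1 dvd5M => /orP[//|/imp].
have n15 : (5 %| n1%:Z)%Z.
  by have : (5 %| m ^+ 4)%Z; [rewrite exprS dvd5M m5 | move: cg1; move: (m ^+ 4) => ?; lia].
have R5 : (5 %| R.[1])%Z by rewrite R1 dvd5M m5.
have n25 : (5 %| n2%:Z)%Z.
  by have : (5 %| R.[1] ^+ 4)%Z; [rewrite exprS dvd5M R5 | move: cg2; move: (R.[1] ^+ 4) => ?; lia].
have [g1 zg1 g1E] : dv lam (ev z f) by apply/dv_lam_ev.
have [g2 zg2 g2E] : dv lam (ev z R) by apply/dv_lam_ev.
set b := nmn g1; set c := nmn g2.
have n1E : n1 = (5 * b)%N by rewrite /n1 g1E nmnM ?nmn_lam //; exact: zint_lam.
have n2E : n2 = (5 * c)%N by rewrite /n2 g2E nmnM ?nmn_lam //; exact: zint_lam.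
have /dvdzP[a aE] := m5.
have dE3 : d = 5 ^+ 3 * (a * b%:Z * c%:Z).
  by rewrite dE' n1E n2E aE !PoszM; ring.
have [/dvdzP[e eE]|nabc] := boolP (5 %| a * b%:Z * c%:Z)%Z.
  by constructor 2; rewrite dE3 eE; apply/dvdzP; exists e; ring.
constructor 3.
move: (nabc); rewrite !dvd5M !negb_or => /andP[/andP[na nb] nc].
(* Compare m + 5 k(1) with m n1, where m = 5a and n1 = 5b. Thus k(1) is -a modulo 5, which is
   nonzero, and [lam] does not divide k(z). *)
have k1E : k.[1] = 5 * (a * b%:Z) - a.
  have : 5 * k.[1] = 5 * (5 * (a * b%:Z) - a).
    have -> : 5 * k.[1] = m * n1%:Z - m by rewrite -R1 R1'; ring.
    by rewrite n1E aE PoszM; ring.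
  by move/(mulfI (isT : (5 : int) != 0)).
have zk : zint (ev z k) by exists k.
set u := z ^+ 2 * (1 + z) ^+ 2.
have hu : conj_unit u.
  by apply: conj_unitM; apply: conj_unitX; [exact: conj_unit_z | exact: conj_unit_1z].
have [zu nu _] := hu.
have nlam x : zint x -> ~~ (5 %| (nmn x)%:Z)%Z -> ~ dv lam x.
  by move=> zx /negP nx h; apply: nx; have := dv_nmn zint_lam h; rewrite nmn_lam dvdzE.
(* The difference of the two values is 5 k(z) = lam^4 u k(z), and one factor [lam] is removed from
   both. *)
have gE : g2 - g1 = lam ^+ 3 * (u * ev z k).
  apply: (mulfI lam_neq0); rewrite mulrBr -g1E -g2E /R evD evM ev_nat five_lam -/u; ring.
have nbb : ~ dv lam (u * ev z k).
  case/(dv_lamM zu zk) => [|/dv_lam_ev].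
    by apply: nlam => //; rewrite nu.
  rewrite k1E => /dvdzP[e he]; move/negP: na; apply; apply/dvdzP.
  by exists (a * b%:Z - e); rewrite mulrBl -he; ring.
have ng : ~ (good g1 /\ good g2).
  move=> [h1 h2]; apply: not_both_good gE nbb _ h1 h2 => //; first by zint.
  exact: nlam.
have [h1|h1] := classic (good g1).
  have h2 : ~ good g2 by move=> h2; apply: ng.
  have [q pq /dvdnP[t tE]] := perissad_dvd zg2 (nlam _ zg2 nc) h2.
  exists q, (a * b%:Z * t%:Z); split=> //; rewrite coprimez5; move: nabc.
  rewrite dE3 /c tE PoszM => nabc; split; last by ring.
  by move: nabc; rewrite !dvd5M !negb_or => /andP[/andP[-> ->] /andP[-> _]].
have [q pq /dvdnP[t tE]] := perissad_dvd zg1 (nlam _ zg1 nb) h1.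
exists q, (a * t%:Z * c%:Z); split=> //; rewrite coprimez5; move: nabc.
rewrite dE3 /b tE PoszM => nabc; split; last by ring.
by move: nabc; rewrite !dvd5M !negb_or => /andP[/andP[-> /andP[-> _]] ->].
Qed.

(** * Realizing determinants *)

(* Adding multiples of [1 + X + .. + X^24] changes the value at [1] only. *)
Lemma realize (f : {poly int}) (c t d : int) :
  \prod_(j < 24) ev (w ^+ j.+1) f = c%:~R -> (f.[1] + 25 * t) * c = d ->
  exists a : nat -> int, \det (circulant 25 a) = d.
Proof.
move=> fc dE; pose g := f + t%:P * \sum_(i < 25) 'X^i.
have [a ha] := circulant_of_poly g; exists a; apply: (@intr_inj algC).
rewrite ha prod_w -dE rmorphM /= -fc; congr (_ * _).
  rewrite ev_at1 /g hornerD hornerM hornerC horner_sum.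
  by under eq_bigr do rewrite hornerXn expr1n; rewrite sumr_const card_ord mulrC.
apply: eq_bigr => j _; rewrite /g evD evM.
have -> : ev (w ^+ j.+1) (\sum_(i < 25) 'X^i) = 0.
  have y1 : w ^+ j.+1 - 1 != 0.
    by rewrite subr_eq0 -(prim_order_dvd w_prim) gtnNdvd // ltnS.
  apply: (mulfI y1); rewrite mulr0.
  have := congr1 (ev (w ^+ j.+1)) (subrX1 ('X : {poly int}) 25).
  rewrite evM !(evD, evN, evXn, evX, ev1) => <-.
  by rewrite exprAC w_exp25 expr1n subrr.
by rewrite mulr0 addr0.
Qed.

(** f = (X^m - 1)/(X - 1) has value [m] at 1 and takes unit values at the other 25th roots of unity:
    as m m' = 1 modulo 25, [f'] takes the inverse values there. *)
Lemma realize_coprime (d : int) : coprimez d 5 ->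
  exists a : nat -> int, \det (circulant 25 a) = d.
Proof.
rewrite coprimez5 => nd.
have [m mE] : exists m : nat, (d %% 25)%Z = m by exists `|(d %% 25)%Z|%N; lia.
have dE := divz_eq d 25; rewrite mE in dE.
have cm : coprime m 25.
  by rewrite (_ : 25 = 5 ^ 2)%N // coprimeXr // coprime_sym prime_coprime //; lia.
(* 19 is one less than the totient 20 of 25. *)
pose m' := (m ^ 19)%N.
have mm : (m * m' = 1 %[mod 25])%N by rewrite -expnS; exact: Euler_exp_totient cm.
pose f : {poly int} := \sum_(i < m) 'X^i.
pose f' : {poly int} := \sum_(i < m') ('X^m) ^+ i.
have ff' (j : 'I_24) : ev (w ^+ j.+1) f * ev (w ^+ j.+1) f' = 1.
  have y1 : w ^+ j.+1 - 1 != 0.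
    by rewrite subr_eq0 -(prim_order_dvd w_prim) gtnNdvd // ltnS.
  apply: (mulfI y1); rewrite mulr1 mulrA.
  have e : ('X - 1) * f * f' = 'X^m ^+ m' - 1 by rewrite -subrX1 -subrX1.
  have := congr1 (ev (w ^+ j.+1)) e; rewrite !evM !(evD, evN, evXn, evX, ev1) => ->.
  rewrite -exprM; congr (_ - 1); rewrite -!exprM; apply/eqP.
  rewrite (eq_prim_root_expr w_prim); apply/eqP.
  by rewrite -modnMmr mm modnMmr muln1.
have tn (g : {poly int}) : exists n : nat, \prod_(j < 24) ev (w ^+ j.+1) g = n%:R.
  have [k [-> _]] := norm_factor g.
  exists (nmn (ev z g) * nmn (ev z (g + 5 * k)))%N.
  by rewrite natrM -!nmnE //; [exists (g + 5 * k) | exists g].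
have [n hn] := tn f; have [n' hn'] := tn f'.
(* Both products are natural numbers, so being mutually inverse forces the value 1, without a
   sign. *)
have nn : (n * n' == 1)%N.
  by rewrite -(eqr_nat algC) natrM -hn -hn' -big_split /= big1 // => j _; apply: ff'.
have n1 : n = 1%N by move: nn; rewrite muln_eq1 => /andP[/eqP].
apply: (@realize f 1 (d %/ 25)%Z); first by rewrite hn n1.
rewrite /f horner_sum.
under eq_bigr do rewrite hornerXn expr1n.
by rewrite sumr_const card_ord mulr1 [RHS]dE addrC [25 * _]mulrC -(natz m).
Qed.

(** The relative norm of w^i - 1 is z^i - 1, and the product of these over i = 1, .., 4 is the norm
    5 of [lam]. *)
Lemma prod_X_sub_1 (f : {poly int}) :
  (forall j, ~~ (5 %| j)%N -> ev (w ^+ j) f = w ^+ j - 1) ->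
  \prod_(j < 24) ev (w ^+ j.+1) f = nm (ev z f) * 5.
Proof.
move=> hf; rewrite (prod24 (fun j => ev (w ^+ j) f)) nm_ev.
rewrite (w_exp 1) (w_exp 2) (w_exp 3) (w_exp 4) expr1; congr (_ * _).
rewrite !hf //.
have step i : (w ^+ i - 1) * (w ^+ (i + 5) - 1) * (w ^+ (i + 10) - 1) * (w ^+ (i + 15) - 1)
    * (w ^+ (i + 20) - 1) = z ^+ i - 1.
  rewrite -[z ^+ i]w_exp mulnC exprM !exprD w_exp5 (w_exp 2) (w_exp 3) (w_exp 4).
  set t := w ^+ i; have := @lin5_prod_all z (-1) t 0 0 0 z_sum.
  have -> : lin5 1 (-1) t 0 0 0 = t - 1 by rewrite /lin5; ring.
  have l5 y : lin5 y (-1) t 0 0 0 = t * y - 1 by rewrite /lin5; ring.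
  rewrite !l5 => <-; rewrite /nmform /acor0 /acor1 /acor2; ring.
rewrite (step 1) (step 2) (step 3) (step 4) expr1.
have := nmnE zint_lam; rewrite nmn_lam => <-.
have -> : lam = ev z ('X - 1) by rewrite !evE.
by rewrite nm_ev !(evD, evN, evX, ev1).
Qed.

Lemma realize_625 (d : int) : (5 ^+ 4 %| d)%Z ->
  exists a : nat -> int, \det (circulant 25 a) = d.
Proof.
(* X - 1 vanishes at 1 and has product 5 * 5 over the other roots, so the free summand 25 t yields
   25 t * 25 = 5^4 t. *)
move=> /dvdzP[t ->]; apply: (@realize ('X - 1) 25 t).
  rewrite prod_X_sub_1; last by move=> j _; rewrite !(evD, evN, evX, ev1).
  by rewrite !(evD, evN, evX, ev1) -/lam nmnE ?nmn_lam; [rewrite -natrM | exact: zint_lam].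
by rewrite hornerD hornerN hornerX hornerC; ring.
Qed.

(** Applying [sg] keeps the norm and sends [lam] to (z + 1) lam, so h becomes (X + 1)^3 h(X^2),
    whose value at 1 is 8 h(1). As 8 generates the units modulo 5, h(1) can be brought to any
    nonzero class. *)
Lemma perissad_witness q (m : int) : perissad q -> ~~ (5 %| m)%Z ->
  exists2 h : {poly int}, (5 %| h.[1] + m)%Z & q%:R = nm (1 + lam ^+ 3 * ev z h).
Proof.
move=> [_ _ [h [nh hq]]] nm5.
have step i : exists2 g : {poly int}, g.[1] = 8 ^+ i * h.[1] &
    q%:R = nm (1 + lam ^+ 3 * ev z g).
  elim: i => [|i [g g1 gq]].
    by exists h; [rewrite mul1r | rewrite hq Nk_nm !(evD, evN, evM, evXn, evX, ev1)].
  exists (('X + 1) ^+ 3 * (g \Po 'X^2)).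
    rewrite hornerM horner_comp hornerXn expr1n g1 horner_exp hornerD hornerX hornerC [in RHS]exprS.
    by ring.
  have zx : zint (1 + lam ^+ 3 * ev z g) by zlam; exists g.
  rewrite gq nmnE // -(nmn_sg zx) -nmnE; last by zint.
  congr nm; rewrite rmorphD rmorph1 rmorphM rmorphXn /= ev_rmorph sg_z.
  rewrite evM ev_comp !evXn evD evX ev1 /lam rmorphB rmorph1 /= sg_z.
  by ring.
have [i hi] : exists i, (5 %| 8 ^+ i * h.[1] + m)%Z.
  have [] := (divz_eq h.[1] 5, divz_eq m 5).
  have : (h.[1] %% 5)%Z \in [:: 1; 2; 3; 4] by rewrite !inE; lia.
  have : (m %% 5)%Z \in [:: 1; 2; 3; 4] by rewrite !inE; lia.
  move: (h.[1] %/ 5)%Z (m %/ 5)%Z (h.[1] %% 5)%Z (m %% 5)%Z => a b c e.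
  rewrite !inE => hc he -> ->; move: hc he.
  move=> /orP[/eqP->|/orP[/eqP->|/orP[/eqP->|/eqP->]]];
  move=> /orP[/eqP->|/orP[/eqP->|/orP[/eqP->|/eqP->]]];
  first [exists 0%N; rewrite ?(exprS, expr0); lia | exists 1%N; rewrite ?(exprS, expr0); lia
    | exists 2%N; rewrite ?(exprS, expr0); lia | exists 3%N; rewrite ?(exprS, expr0); lia].
by have [g g1 gq] := step i; exists g; rewrite ?g1.
Qed.

Lemma realize_perissad q (m : int) : perissad q -> coprimez m 5 ->
  exists a : nat -> int, \det (circulant 25 a) = 5 ^+ 3 * q%:Z * m.
Proof.
rewrite coprimez5 => pq nm5; have [h /dvdzP[t ht] hq] := perissad_witness pq nm5.
pose Phi : {poly int} := \sum_(i < 5) ('X^5) ^+ i.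
(* [Phi], the 25th cyclotomic polynomial, is 0 at primitive 25th roots of unity and 5 at fifth
   roots; since lam^4 = -5 (z^3 - z^2 + z), its multiplier adds lam^4 h(z) at z. *)
pose f := 'X - 1 + Phi * (- ('X^3 - 'X^2 + 'X) * h).
have Phi0 j : ~~ (5 %| j)%N -> ev (w ^+ j) Phi = 0.
  move=> nj; have y1 : w ^+ j ^+ 5 - 1 != 0.
    by rewrite -exprM mulnC w_exp subr_eq0 -(prim_order_dvd z_prim).
  apply: (mulfI y1); rewrite mulr0.
  have := congr1 (ev (w ^+ j)) (subrX1 ('X^5 : {poly int}) 5).
  rewrite -/Phi evM !(evD, evN, evXn, evX, ev1) => <-.
  by rewrite -exprM exprAC (w_exp 5) z_exp5 expr1n subrr.
have Phi5 y : y ^+ 5 = 1 -> ev y Phi = 5.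
  move=> y5; rewrite /Phi !big_ord_recl big_ord0 !(evD, evXn, evX) y5 !expr1n.
  by rewrite /ev rmorph0 horner0; ring.
have lam4 : lam ^+ 4 = - 5 * (z ^+ 3 - z ^+ 2 + z).
  apply/eqP; rewrite -subr_eq0 -[X in _ == X]z_sum /lam; apply/eqP; ring.
have fz : ev z f = lam * (1 + lam ^+ 3 * ev z h).
  rewrite /f evD evM Phi5 ?z_exp5 // !(evD, evN, evM, evXn, evX, ev1) -/lam.
  have -> : lam * (1 + lam ^+ 3 * ev z h) = lam + lam ^+ 4 * ev z h by ring.
  by rewrite lam4; ring.
(* With h(1) + m = 5t and f(1) = -5 h(1), the value at 1 becomes -5 h(1) + 25 t = 5m. *)
apply: (@realize f (25 * q%:Z) t).
  rewrite prod_X_sub_1; last first.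
    by move=> j nj; rewrite /f evD evM Phi0 // mul0r addr0 !(evD, evN, evX, ev1).
  rewrite fz nmM -hq nmnE; last exact: zint_lam.
  by rewrite nmn_lam rmorphM /= -[(q%:Z)%:~R]/(q%:R); ring.
have f1 : f.[1] = - 5 * h.[1].
  apply: (@intr_inj algC); rewrite -ev_at1 /f evD evM Phi5 ?expr1n //.
  by rewrite !(evD, evN, evM, evXn, evX, ev1) ev_at1 !rmorphM rmorphN /=; ring.
have -> : m = t * 5 - h.[1] by rewrite -ht; ring.
by rewrite f1; ring.
Qed.

Theorem theorem1p2 (d : int) :
  (exists a : nat -> int, \det (circulant 25 a) = d) <->
  [\/ coprimez d 5,
      (5 ^+ 4 %| d)%Z
    | exists (q : nat) (m : int),
        perissad q /\ coprimez m 5 /\ d = 5 ^+ 3 * q%:Z * m].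
Proof.
split=> [[a <-]|[/realize_coprime|/realize_625|[q [m [pq [cm ->]]]]]] //.
  exact: group_det_cases (det_circulant a).
exact: realize_perissad.
Qed.
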